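(* Let $\phi\in L^2(0,\infty)$ be positive and continuous on $[0,\infty)$ with $\phi'\in L^2_{\rm loc}[0,\infty)$. Suppose there exist positive constants $c,c_1,c_2$ such that $$c_1e^{-\sigma(x)}\le\phi(x)\le c_2e^{-\sigma(x)}\qquad\text{for all }x\ge0,$$ where $\sigma$ is a $C^1$ function on $[0,\infty)$ such that $\sigma'(x)\ge c$ for all $x\ge0$. Suppose also that $$\lim_{x\to\infty}\left\{(\sigma'(x))^2-\sigma''(x)\right\}=+\infty.$$ Let $H$ be the self-adjoint operator in $L^2(0,\infty)$, with Dirichlet boundary condition at $0$, associated with $\phi$ as in the context. Then the essential spectrum of $H$ is empty, and the eigenvalues $\lambda_n$ of $H$ grow at the same rate as those of the Schrödinger operator $\tilde H$ in $L^2(0,\infty)$ with Dirichlet boundary condition at $0$, where $$\tilde Hf=-f''+\tilde Vf,\qquad \tilde V=(\sigma')^2-\sigma''.$$ Here ''grow at the same rate'' means that, if $\tilde\lambda_n$ are the eigenvalues of $\tilde H$, there is a constant $C\ge1$ such that $C^{-1}\tilde\lambda_n\le\lambda_n\le C\tilde\lambda_n$ for all $n\ge1$, both sequences being written in increasing order and repeated according to multiplicity.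
   Context: The condition on $\phi'$ means that $\phi(x)=\phi(0)+\int_0^x \phi'(s)\,ds$ for all $x\ge0$, where $\phi'\in L^2(0,a)$ for every $a>0$ is the weak derivative. Given such a $\phi$, put $$\psi(x)=\phi(x)\int_0^x\frac{ds}{\phi(s)^2},\qquad G(x,y)=\begin{cases}\psi(x)\phi(y)&0\le x\le y<\infty,\\ \phi(x)\psi(y)&0\le y\le x<\infty.\end{cases}$$ Under the stated two-sided bound on $\phi$, the formula $(Gf)(x)=\int_0^\infty G(x,y)f(y)\,dy$ is known to define a bounded operator on $L^2(0,\infty)$ which is self-adjoint, non-negative, injective and has dense range. The operator $H=G^{-1}$, with $\mathrm{Dom}(H)=\mathrm{Ran}(G)$, is then self-adjoint and positive; it acts as $Hg=\phi^{-1}(\phi'g-\phi g')'$, and every $g\in\mathrm{Dom}(H)$ satisfies $g(0)=0$. The operator $\tilde H$ is the operator obtained by the same construction with $\phi$ replaced by $e^{-\sigma}$; its potential is $\tilde V=(e^{-\sigma})''/e^{-\sigma}=(\sigma')^2-\sigma''$. *)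

(* Defs.v *)
From HB Require Import structures.
From mathcomp Require Import all_boot all_order all_algebra.
From mathcomp Require Import all_classical all_reals all_analysis.
From mathcomp Require Import complex.

Set Implicit Arguments.
Unset Strict Implicit.
Unset Printing Implicit Defensive.
Import Order.TTheory GRing.Theory Num.Theory.
Import numFieldNormedType.Exports.

Local Open Scope classical_set_scope.
Local Open Scope ring_scope.
Local Open Scope complex_scope.

Section Calculus.
Context {R : realType}.
Implicit Types (f df phi : R -> R) (x y : R).
Local Notation mu := (@lebesgue_measure R).

Definition half_line : set R := `]0, +oo[%classic.

(* [f] is of class C^1 on [0, +oo[ with derivative [df]; the derivative at 0
   is one-sided, and the values of [f] and [df] on ]-oo, 0[ are irrelevant. *)
Definition C1_half_line f df : Prop :=
  (forall x, 0 <= x ->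
     (f y - f x) / (y - x) @[y --> within `[0, +oo[%classic x^'] --> df x) /\
  {within `[0, +oo[%classic, continuous df}.

(* [df] is a representative of the weak derivative of [f] on [a, +oo[. *)
Definition weak_derivative_from (a : R) f df : Prop :=
  forall x, a <= x ->
    mu.-integrable `[a, x]%classic (EFin \o df) /\
    f x = f a + \int[mu]_(s in `[a, x]%classic) df s.

Definition square_integrable (D : set R) f : Prop :=
  measurable_fun D f /\ mu.-integrable D (EFin \o (fun x => f x ^+ 2)).

Definition psi phi x : R :=
  phi x * \int[mu]_(s in `[0, x]%classic) (phi s ^+ 2)^-1.

Definition green phi x y : R :=
  if x <= y then psi phi x * phi y else phi x * psi phi y.

End Calculus.

(* Vectors of the complex Hilbert space L^2(0, +oo) are represented by
   functions R -> R[i], considered up to [ae_eq mu half_line]; the values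
   outside ]0, +oo[ are irrelevant. *)
Section L2.
Context {R : realType}.
Implicit Types (f g : R -> R[i]) (z : R[i]).
Local Notation mu := (@lebesgue_measure R).

Definition L2 f : Prop :=
  square_integrable half_line (fun x => complex.Re (f x)) /\
  square_integrable half_line (fun x => complex.Im (f x)).

Definition L2norm f : R :=
  Num.sqrt (\int[mu]_(x in half_line)
              (complex.Re (f x) ^+ 2 + complex.Im (f x) ^+ 2)).

Definition L2eq f g : Prop := ae_eq mu half_line f g.

Definition cintegral (D : set R) f : R[i] :=
  (\int[mu]_(x in D) complex.Re (f x)) +i*
  (\int[mu]_(x in D) complex.Im (f x)).

(* A possibly unbounded operator is given by its graph: [A g f] means that
   [g] belongs to Dom(A) and that A g = f. *)
Definition operator : Type := (R -> R[i]) -> (R -> R[i]) -> Prop.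

Definition Gop (phi : R -> R) f : R -> R[i] :=
  fun x => cintegral half_line (fun y => (green phi x y)%:C * f y).

(* H = G^-1, with Dom(H) = Ran(G). *)
Definition Hop (phi : R -> R) : operator :=
  fun g f => [/\ L2 g, L2 f & L2eq g (Gop phi f)].

(* The graph of A - z. *)
Definition shift_op (A : operator) z : operator :=
  fun g f => A g (fun x => f x + z * g x).

(* A - z is a bijection from Dom(A) onto L^2 with bounded inverse;
   injectivity is the case f = 0 of the bound. *)
Definition resolvent_set (A : operator) : set R[i] :=
  [set z | (forall f, L2 f -> exists g, shift_op A z g f) /\
           (exists M : R, forall g f, shift_op A z g f ->
              L2norm g <= M * L2norm f)].

Definition spectrum (A : operator) : set R[i] := ~` resolvent_set A.

Definition op_eigenspace (A : operator) z : set (R -> R[i]) :=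
  [set g | A g (fun x => z * g x)].

(* The subspace of L^2 represented by [E] has dimension [n]. *)
Definition has_dim (E : set (R -> R[i])) (n : nat) : Prop :=
  exists e : 'I_n -> R -> R[i],
  [/\ forall i, E (e i),
      forall a : 'I_n -> R[i],
        L2eq (fun x => \sum_(i < n) a i * e i x) (fun=> 0) ->
        forall i, a i = 0
    & forall g, E g -> exists a : 'I_n -> R[i],
        L2eq g (fun x => \sum_(i < n) a i * e i x)].

(* Isolated points of the spectrum that are eigenvalues of finite
   multiplicity. *)
Definition discrete_spectrum (A : operator) : set R[i] :=
  [set z | (exists2 e : R, 0 < e &
              forall w : R[i], w != z -> `|w - z| < e%:C -> resolvent_set A w) /\
           (exists2 n, (0 < n)%N & has_dim (op_eigenspace A z) n)].

Definition essential_spectrum (A : operator) : set R[i] :=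
  spectrum A `\` discrete_spectrum A.

(* [lam 0 <= lam 1 <= ...] lists all the eigenvalues of A, each repeated
   according to its (finite) multiplicity; as [z] ranges over R[i], this
   includes that there is no non-real eigenvalue. *)
Definition eigenvalue_enumeration (A : operator) (lam : nat -> R) : Prop :=
  {homo lam : m n / (m <= n)%N >-> m <= n} /\
  forall z : R[i], exists2 n, has_dim (op_eigenspace A z) n &
    ([set k | (lam k)%:C = z] #= `I_n)%card.

End L2.

(* Main.v *)
Require Import Defs.
From HB Require Import structures.
From mathcomp Require Import all_boot all_order all_algebra.
From mathcomp Require Import all_classical all_reals all_analysis.
From mathcomp Require Import measurable_realfun complex ring lra.

Set Implicit Arguments.
Unset Strict Implicit.
Unset Printing Implicit Defensive.
Import Order.TTheory GRing.Theory Num.Theory.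
Import numFieldNormedType.Exports.

Local Open Scope classical_set_scope.
Local Open Scope ring_scope.

(** The Green operator factors as [G = K^* K], where [K] has the kernel
    [phi x / phi s] on [0 < s <= x]. The two-sided bound and [sigma' >= c] make
    this kernel at most [kappa * exp (- c * (x - s))], so [K] is bounded on L^2
    by the Schur test. Since [sigma'] solves [p' = p^2 - V] with [p >= c] and
    [V --> +oo], it tends to [+oo]: the part of [K] living far out is therefore
    small, and the rest is approximated by operators of finite rank, by cutting
    [(0, N)] into short cells. Hence [K] is compact, and [G] has an orthonormal
    basis of real eigenvectors with eigenvalues [mu_n] decreasing to [0]. In this
    basis [H] is diagonal with entries [lam_n = 1 / mu_n --> +oo], which gives
    its whole spectrum. If [m = phi * exp sigma], then [K = m^-1 Kt m] where [Kt]
    is the operator [K] of [exp (- sigma)], and [c1 <= m <= c2]; by the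
    Courant-Fischer principle the eigenvalues of [K^* K] and [Kt^* Kt] then
    differ by at most the factor [(c2 / c1)^2]. *)

(** * Positive semidefinite forms and orthonormal systems *)

Section PsdForm.
Context {R : realType} {V : lmodType R}.
Implicit Types (q : V -> V -> R) (u v w : V).

(** Vectors are functions, not classes modulo almost everywhere equality, so the inner product is
    only semidefinite. Hence the abstract theory of semidefinite forms, with conclusions of the
    shape [dot v v = 0] instead of [v = 0]. The kernels are real, so the spectral theory is done
    over the reals; complex functions enter at the end, through their real and imaginary parts. The
    unbounded operators are never compared directly. Only their bounded inverses are, through the
    forms [<G f, f> = |K f|^2], so that no domain of a differential operator has to be described.
    The potential is used once, for the growth of [sigma']. As [sigma'] has only a weak derivative,
    that Riccati argument is carried out on integrals. Fast decay far out is of no help near [0],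
    where the kernel decays at the fixed rate [c] only. What helps there is that [phi x / phi s] is
    a product of functions of one variable: everything to the right of a cell has finite rank, and
    what remains inside the cell has a norm governed by its length. *)

Record psd_form q : Prop := PsdForm {
  form_sym : forall u v, q u v = q v u;
  form_lin : forall k u v w, q (k *: u + v) w = k * q u w + q v w;
  form_ge0 : forall u, 0 <= q u u }.

Context q (Q : psd_form q).

Lemma form0l w : q 0 w = 0.
Proof.
have := form_lin Q (-1) 0 0 w.
by rewrite scaler0 addr0 mulN1r addNr.
Qed.

Lemma formDl u v w : q (u + v) w = q u w + q v w.
Proof. by have := form_lin Q 1 u v w; rewrite scale1r mul1r. Qed.

Lemma formZl k u w : q (k *: u) w = k * q u w.
Proof. by have := form_lin Q k u 0 w; rewrite addr0 form0l addr0. Qed.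

Lemma formNl u w : q (- u) w = - q u w.
Proof. by rewrite -scaleN1r formZl mulN1r. Qed.

Lemma formBl u v w : q (u - v) w = q u w - q v w.
Proof. by rewrite formDl formNl. Qed.

Lemma formDr u v w : q w (u + v) = q w u + q w v.
Proof. by rewrite !(form_sym Q w) formDl. Qed.

Lemma formZr k u w : q w (k *: u) = k * q w u.
Proof. by rewrite !(form_sym Q w) formZl. Qed.

Lemma formBr u v w : q w (u - v) = q w u - q w v.
Proof. by rewrite !(form_sym Q w) formBl. Qed.

Lemma form_suml (I : Type) (r : seq I) (P : pred I) (F : I -> V) w :
  q (\sum_(i <- r | P i) F i) w = \sum_(i <- r | P i) q (F i) w.
Proof.
by elim/big_ind2 : _ => [|u x v y <- <-|//]; rewrite ?form0l// formDl.
Qed.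

Lemma form_sumr (I : Type) (r : seq I) (P : pred I) (F : I -> V) w :
  q w (\sum_(i <- r | P i) F i) = \sum_(i <- r | P i) q w (F i).
Proof.
by rewrite form_sym// form_suml; apply: eq_bigr => i _; rewrite form_sym.
Qed.

Lemma form_eq0 u v : q u u = 0 -> q u v = 0.
Proof.
move=> u0; apply/eqP; rewrite -[_ == _]negbK; apply/negP => uv.
(* As [q u u = 0], the form at [k *: u + v] is affine in [k]; this [k] makes it [-1]. *)
have := form_ge0 Q ((- (q v v + 1) / (2 * q u v)) *: u + v).
rewrite formDl !formDr !formZl !formZr u0 (form_sym Q v u).
rewrite (_ : _ + _ = - 1); first by lra.
by field.
Qed.

Lemma form_CS u v : q u v ^+ 2 <= q u u * q v v.
Proof.
have [u0|u0] := eqVneq (q u u) 0.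
  by rewrite (form_eq0 _ u0) u0 mul0r expr0n.
have ugt0 : 0 < q u u by rewrite lt_neqAle eq_sym u0 form_ge0.
have := form_ge0 Q (q u u *: v - q u v *: u).
rewrite formBl !formBr !formZl !formZr (form_sym Q v u) => h.
have {}h : 0 <= q u u * (q u u * q v v - q u v ^+ 2) by move: h; nra.
by move: h; rewrite pmulr_rge0// subr_ge0.
Qed.

Lemma formD_le u v : q (u + v) (u + v) <= 2 * (q u u + q v v).
Proof.
have := form_ge0 Q (u - v).
rewrite formBl !formBr formDl !formDr (form_sym Q v u); lra.
Qed.

(** The crude factor comes from iterating [formD_le]. It is harmless for compactness, where it is
    absorbed in the finitely many functionals. *)
Lemma form_sum_le (m : nat) (F : nat -> V) :
  q (\sum_(i < m) F i) (\sum_(i < m) F i) <= 2 ^+ m * \sum_(i < m) q (F i) (F i).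
Proof.
elim: m => [|m ih]; first by rewrite !big_ord0 form0l mulr0.
rewrite !big_ord_recr /= (le_trans (formD_le _ _))// exprS -mulrA ler_pM2l//.
rewrite mulrDr lerD// ler_peMl//; first exact: form_ge0.
by rewrite exprn_ege1// ler1n.
Qed.

End PsdForm.

(** * Limits in the seminorm; Bessel, Riesz-Fischer and Parseval *)

Section HilbertBasis.
Context {R : realType} {V : lmodType R}.
Variables (dot : V -> V -> R) (dotQ : psd_form dot).
Implicit Types (u v w : V) (x e : nat -> V).

(** Convergence for the seminorm, written with its square to avoid roots; a limit is unique up to a
    null vector only. *)
Definition form_cvg x u : Prop := dot (x k - u) (x k - u) @[k --> \oo] --> (0 : R).

Definition form_complete : Prop := forall x,
  (forall eps, 0 < eps -> exists N, forall k l, (N <= k)%N -> (N <= l)%N ->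
     dot (x k - x l) (x k - x l) <= eps) ->
  exists u, form_cvg x u.

(** Cauchy-Schwarz for [q] controls [q (x k - u) w], so every form dominated by [dot] passes to the
    limit, not only [dot] itself. *)
Lemma cvg_form_left (q : V -> V -> R) (C : R) x u w : psd_form q ->
  (forall v, q v v <= C * dot v v) ->
  form_cvg x u -> q (x k) w @[k --> \oo] --> q u w.
Proof.
move=> Q qC xu.
suff: q (x k) w - q u w @[k --> \oo] --> (0 : R) by move/subr_cvg0.
apply/norm_cvg0P.
apply: (@squeeze_cvgr _ _ _ _ (fun=> 0)
  (fun k => Num.sqrt (C * dot (x k - u) (x k - u) * q w w))).
- apply: nearW => k; rewrite normr_ge0/= -formBl// -sqrtr_sqr ler_wsqrtr//.
  by apply: le_trans (form_CS Q _ _) _; rewrite ler_wpM2r// form_ge0.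
- exact: cvg_cst.
- rewrite -[X in _ --> X]sqrtr0; apply: (continuous_cvg _ (@sqrt_continuous R _)).
  rewrite -[X in _ --> X](mul0r (q w w)); apply: cvgM; last exact: cvg_cst.
  by rewrite -[X in _ --> X](mulr0 C); apply: cvgM => //; exact: cvg_cst.
Qed.

Lemma cvg_form_diag (q : V -> V -> R) (C : R) x u : psd_form q ->
  (forall v, q v v <= C * dot v v) ->
  form_cvg x u -> q (x k) (x k) @[k --> \oo] --> q u u.
Proof.
move=> Q qC xu.
have -> : (fun k => q (x k) (x k)) =
    (fun k => q (x k - u) (x k - u) + 2 * q (x k) u - q u u).
  apply/funext => k; rewrite formBl// !formBr// (form_sym Q u).
  ring.
rewrite [X in _ --> X](_ : q u u = 0 + 2 * q u u - q u u); last by ring.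
have h0 : q (x k - u) (x k - u) @[k --> \oo] --> (0 : R).
  apply: (@squeeze_cvgr _ _ _ _ (fun=> 0) (fun k => C * dot (x k - u) (x k - u))).
  - by apply: nearW => k; rewrite form_ge0//= qC.
  - exact: cvg_cst.
  - by rewrite -[X in _ --> X](mulr0 C); apply: cvgM => //; exact: cvg_cst.
have h1 : 2 * q (x k) u @[k --> \oo] --> 2 * q u u.
  by apply: cvgM; [exact: cvg_cst|exact: (cvg_form_left Q qC xu)].
apply: (cvgB (cvgD h0 h1)).
exact: cvg_cst.
Qed.

Lemma cvg_dot_left x u w : form_cvg x u -> dot (x k) w @[k --> \oo] --> dot u w.
Proof. by apply: (@cvg_form_left dot 1) => // v; rewrite mul1r. Qed.

Lemma cvg_dot_diag x u : form_cvg x u ->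
  dot (x k) (x k) @[k --> \oo] --> dot u u.
Proof. by apply: (@cvg_form_diag dot 1) => // v; rewrite mul1r. Qed.

Definition orthonormal_upto n e : Prop :=
  forall i j, (i < n)%N -> (j < n)%N -> dot (e i) (e j) = (i == j)%:R.

Lemma dot_sum_orthonormal n e (a : nat -> R) m j : orthonormal_upto n e ->
  (m <= n)%N -> (j < n)%N ->
  dot (\sum_(i < m) a i *: e i) (e j) = if (j < m)%N then a j else 0.
Proof.
move=> eO mn jn; rewrite form_suml//.
have E (i : 'I_m) : dot (a i *: e i) (e j) = if i == j :> nat then a j else 0.
  rewrite formZl// eO//; last exact: leq_trans mn.
  by case: eqP => [->|]; rewrite ?mulr1 ?mulr0.
under eq_bigr do rewrite E.
case: ifPn => jm; last first.
  apply: big1 => i _; case: eqP => // ij.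
  by move: jm; rewrite -ij ltn_ord.
rewrite (bigD1 (Ordinal jm))//= eqxx big1 ?addr0// => i.
by rewrite -val_eqE/= => /negbTE ->.
Qed.

Lemma dot_sum_sqr n e (a : nat -> R) m : orthonormal_upto n e -> (m <= n)%N ->
  dot (\sum_(i < m) a i *: e i) (\sum_(i < m) a i *: e i) = \sum_(i < m) a i ^+ 2.
Proof.
move=> eO mn; rewrite [LHS]form_sumr//; apply: eq_bigr => i _.
have im := ltn_ord i.
by rewrite formZr// (dot_sum_orthonormal a eO)// ?im ?expr2// (leq_trans im).
Qed.

Lemma bessel n e v : orthonormal_upto n e ->
  \sum_(i < n) dot (e i) v ^+ 2 <= dot v v.
Proof.
move=> eO; set p := \sum_(i < n) dot (e i) v *: e i.
have pv : dot p v = \sum_(i < n) dot (e i) v ^+ 2.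
  by rewrite form_suml//; apply: eq_bigr => i _; rewrite formZl.
have pp : dot p p = \sum_(i < n) dot (e i) v ^+ 2.
  exact: (@dot_sum_sqr n e (fun i => dot (e i) v)).
have := form_ge0 dotQ (v - p).
rewrite formBl// !formBr// (form_sym dotQ v p) pp pv; lra.
Qed.

Definition orthonormal e : Prop := forall i j, dot (e i) (e j) = (i == j)%:R.

Definition total_family e : Prop := forall v, (forall i, dot (e i) v = 0) -> dot v v = 0.

(** The sums [S] are monotone and bounded, hence convergent, and [xE] turns this into the Cauchy
    property of [x]. The coefficient along [e j] is constant from rank [j.+1] on. *)
Lemma riesz_fischer e (a : nat -> R) (C : R) : form_complete -> orthonormal e ->
  (forall n, \sum_(i < n) a i ^+ 2 <= C) ->
  exists u, form_cvg (fun n => \sum_(i < n) a i *: e i) u /\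
    forall i, dot (e i) u = a i.
Proof.
move=> cpl eO aC; set x := fun n => \sum_(i < n) a i *: e i.
have eOn n : orthonormal_upto n e by move=> i j _ _; exact: eO.
pose S n := \sum_(i < n) a i ^+ 2.
have Snd : nondecreasing_seq S.
  apply/nondecreasing_seqP => n; rewrite /S big_ord_recr/= lerDl; exact: sqr_ge0.
have Scv : cvgn S.
  apply: nondecreasing_is_cvgn => //; exists C => _ [n _ <-]; exact: aC.
have xE l k : (l <= k)%N -> dot (x k - x l) (x k - x l) = S k - S l.
  move=> lk.
  have kl : dot (x k) (x l) = S l.
    rewrite [LHS]form_sumr//; apply: eq_bigr => i _.
    have il : (i < k)%N := leq_trans (ltn_ord i) lk.
    by rewrite formZr// (dot_sum_orthonormal a (eOn k))// il expr2.
  rewrite formBl// !formBr// (form_sym dotQ (x l)) kl.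
  rewrite !(@dot_sum_sqr k e a)// -/(S k) -/(S l); ring.
have [u xu] : exists u, form_cvg x u.
  apply: cpl => eps eps0.
  have /cvgrPdist_lt/(_ _ eps0)[N _ NS] := Scv.
  have S_le n : S n <= limn S by exact: nondecreasing_cvgn_le.
  have main k l : (N <= l)%N -> (l <= k)%N ->
      dot (x k - x l) (x k - x l) <= eps.
    move=> Nl lk; rewrite xE//.
    have /= := NS _ Nl; have := S_le k; have := S_le l.
    by rewrite ltr_norml => *; lra.
  exists N => k l Nk Nl.
  have [lk|/ltnW kl] := leqP l k; first exact: main.
  by rewrite -opprB formNl// (form_sym dotQ) formNl// opprK main.
exists u; split => // j.
rewrite form_sym//; have h := cvg_dot_left (w := e j) xu.
have h' : dot (x k) (e j) @[k --> \oo] --> a j.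
  apply: cvg_near_cst; exists j.+1 => // k /= jk.
  by rewrite (dot_sum_orthonormal a (eOn k))// jk.
exact: (cvg_unique _ h h').
Qed.

(** The vector [u] rebuilt from the coefficients of [v] differs from [v] by a null vector, so by
    [form_eq0] the two are interchangeable in [dot]. *)
Lemma parseval e v : form_complete -> orthonormal e -> total_family e ->
  \sum_(i < n) dot (e i) v ^+ 2 @[n --> \oo] --> dot v v.
Proof.
move=> cpl eO eT.
have eOn n : orthonormal_upto n e by move=> i j _ _; exact: eO.
have [u [xu ue]] :=
  @riesz_fischer e (fun i => dot (e i) v) _ cpl eO (fun n => bessel v (eOn n)).
have : dot (v - u) (v - u) = 0 by apply: eT => i; rewrite formBr// ue subrr.
move=> vu0.
have vu w : dot v w = dot u w.
  by apply/eqP; rewrite -subr_eq0 -formBl// form_eq0.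
rewrite vu form_sym// vu.
rewrite (_ : (fun n => \sum_(i < n) dot (e i) v ^+ 2) = fun n =>
    dot (\sum_(i < n) dot (e i) v *: e i) (\sum_(i < n) dot (e i) v *: e i)).
  exact: cvg_dot_diag xu.
by apply/funext => n; rewrite (dot_sum_sqr (fun i => dot (e i) v) (eOn n)).
Qed.

End HilbertBasis.

(** * The spectral theorem for compact forms *)

Lemma increasing_seq_ge (t : nat -> nat) : increasing_seq t ->
  forall k, (k <= t k)%N.
Proof.
move=> ti; elim=> // k kt; apply: (leq_ltn_trans kt).
by rewrite ltnNge; have := ti k.+1 k; rewrite !leEnat ltnn => ->.
Qed.

(** Only the first [m] sequences have to converge, so [m] successive extractions suffice and no
    diagonal one is needed. *)
Lemma bolzano_weierstrass_family {R : realType} (m : nat) (u : nat -> nat -> R)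
  (C : nat -> R) : (forall i k, `|u i k| <= C i) ->
  exists2 t : nat -> nat, increasing_seq t &
    forall i, (i < m)%N -> cvgn (u i \o t).
Proof.
move=> uC; elim: m => [|m [t ti tc]]; first by exists id.
have [|s si sc] := @bolzano_weierstrass R (u m \o t).
  by exists (C m); split => [|M CM k _ /=]; [exact: num_real|rewrite (le_trans (uC _ _))// ltW].
exists (t \o s) => [j k|i]; first exact: etrans (ti _ _) (si _ _).
rewrite ltnS leq_eqVlt => /predU1P[->//|/tc].
move=> /cvg_ex[/= l ul]; apply/cvg_ex; exists l => /=.
rewrite -[X in X @ _]/((u i \o t) \o s).
apply: cvg_comp ul => A [N _ NA]; exists N => // k /= Nk; apply: NA => /=.
exact: leq_trans Nk (increasing_seq_ge si k).
Qed.

Section Spectral.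
Context {R : realType} {V : lmodType R}.
Variables (dot : V -> V -> R) (dotQ : psd_form dot).
Implicit Types (a q : V -> V -> R) (u v w : V) (x e : nat -> V).

(* Compactness of an operator [K] with [a u u = |K u|^2]: up to an arbitrarily
   small multiple of the norm, [K] is controlled by finitely many linear
   functionals. *)
Definition form_compact a : Prop := forall eps : R, 0 < eps ->
  exists m (v : nat -> V), forall u,
    a u u <= eps * dot u u + \sum_(i < m) dot (v i) u ^+ 2.

(** In the form in which it is used: there is room left in the orthogonal complement of the
    eigenvectors already found. *)
Definition infinite_dim : Prop := forall n (v : nat -> V),
  exists2 u, dot u u != 0 & forall i, (i < n)%N -> dot (v i) u = 0.

(** Weak form of [A u = mu u] when [a u w = <A u, w>]; for a unit vector the eigenvalue can only be
    [a u u]. *)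
Definition eigenvector a u : Prop := forall w, a u w = a u u * dot u w.

Section NextEigenvector.
Variables (a : V -> V -> R) (aQ : psd_form a) (C : R).
Hypothesis cpl : form_complete dot.
Hypothesis a_bnd : forall v, a v v <= C * dot v v.
Hypothesis a_inj : forall v, a v v = 0 -> dot v v = 0.
Hypothesis a_cpt : form_compact a.
Hypothesis dimV : infinite_dim.

Variables (n : nat) (e : nat -> V).
Hypothesis eO : orthonormal_upto dot n e.
Hypothesis eE : forall i, (i < n)%N -> eigenvector a (e i).

Let W v := forall i, (i < n)%N -> dot (e i) v = 0.

Let W_lin k u v : W u -> W v -> W (k *: u + v).
Proof.
by move=> Wu Wv i ni; rewrite formDr// formZr// Wu// Wv// mulr0 addr0.
Qed.

Let S := [set a v v | v in [set v | W v /\ dot v v = 1]].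
Let m := sup S.

Let normalize v : dot v v != 0 -> W v ->
  exists w, [/\ W w, dot w w = 1 & a v v = dot v v * a w w].
Proof.
move=> v0 Wv; have vgt0 : 0 < dot v v by rewrite lt_neqAle eq_sym v0 form_ge0.
exists ((Num.sqrt (dot v v))^-1 *: v).
have sq : (Num.sqrt (dot v v))^-1 * (Num.sqrt (dot v v))^-1 = (dot v v)^-1.
  by rewrite -invfM -expr2 sqr_sqrtr// ltW.
split.
- by move=> i ni; rewrite (formZr dotQ) Wv// mulr0.
- by rewrite (formZl dotQ) (formZr dotQ) mulrA sq mulVf.
- by rewrite (formZl aQ) (formZr aQ) !mulrA -(mulrA (dot v v)) sq mulfV// mul1r.
Qed.

Let S_sup : has_sup S.
Proof.
split.
  have [u u0 eu] := dimV n e; have [w [Ww w1 _]] := normalize u0 eu.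
  by exists (a w w), w.
by exists C => _ [v [_ v1] <-]; rewrite (le_trans (a_bnd v))// v1 mulr1.
Qed.

Let m_gt0 : 0 < m.
Proof.
have [u u0 eu] := dimV n e; have [w [Ww w1 _]] := normalize u0 eu.
have : a w w <= m by apply: ub_le_sup; [exact: S_sup.2|exists w].
apply: lt_le_trans; rewrite lt_neqAle form_ge0// andbT eq_sym.
by apply/negP => /eqP/a_inj/eqP; rewrite w1 oner_eq0.
Qed.

Let m_max v : W v -> a v v <= m * dot v v.
Proof.
move=> Wv; have [v0|v0] := eqVneq (dot v v) 0.
  by rewrite (le_trans (a_bnd v))// v0 !mulr0.
have [w [Ww w1 ->]] := normalize v0 Wv.
rewrite mulrC ler_wpM2r ?form_ge0//.
by apply: ub_le_sup; [exact: S_sup.2|exists w].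
Qed.

Let b u v := m * dot u v - a u v.

(* [b] is positive semidefinite on [W] only. *)
Let b_ge0 v : W v -> 0 <= b v v.
Proof. by move=> Wv; rewrite subr_ge0 m_max. Qed.

(** Parallelogram identity, with non-negativity used only at [u + v], which lies in [W]. For two
    almost maximizers the right-hand side is small. *)
Let b_diff_le u v : W u -> W v -> b (u - v) (u - v) <= 2 * (b u u + b v v).
Proof.
move=> Wu Wv; have := b_ge0 (W_lin 1 Wu Wv); rewrite /b scale1r.
rewrite !(formBl aQ, formBr aQ, formDl aQ, formDr aQ).
rewrite !(formBl dotQ, formBr dotQ, formDl dotQ, formDr dotQ).
rewrite (form_sym aQ v u) (form_sym dotQ v u); lra.
Qed.

(** A maximizing sequence is thinned out until the functionals of [form_compact] at [eps := m / 2]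
    converge along it. It is then Cauchy: [b_diff_le] bounds [m * D], with [D] the squared distance
    of two terms, by [a] of their difference plus small terms, and compactness bounds the former by
    [m / 2 * D] plus small terms. *)
Let exists_maximizer : exists u, [/\ W u, dot u u = 1 & a u u = m].
Proof.
have /choice[x xP] : forall k : nat, exists v,
    [/\ W v, dot v v = 1 & m - k.+1%:R^-1 < a v v].
  move=> k; have [|_ [v [Wv v1] <-] h] := @sup_adherent _ S k.+1%:R^-1 _ S_sup.
    by rewrite invr_gt0.
  by exists v.
have [|p [v pv]] := a_cpt (eps := m / 2); first by rewrite divr_gt0.
have vB i k : `|dot (v i) (x k)| <= Num.sqrt (dot (v i) (v i)).
  rewrite -sqrtr_sqr ler_wsqrtr//; have := form_CS dotQ (v i) (x k).
  by have [_ -> _] := xP k; rewrite mulr1.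
have [t ti tc] := bolzano_weierstrass_family p vB.
have t_ge := increasing_seq_ge ti.
have [|u xu] := cpl (x := x \o t).
  move=> eps eps0.
  (* The tolerances [m / 16 * eps] and [m / 4 * eps] are those for which
     [m / 2 * D <= 2 * (rk + rl) + s] yields [D <= eps]. *)
  have [N1 N1P] : exists N, forall k, (N <= k)%N -> (k.+1%:R^-1 : R) <= m / 16 * eps.
    have e0 : 0 < m / 16 * eps by rewrite mulr_gt0// divr_gt0.
    have /cvgrPdist_le/(_ _ e0)[N _ NP] := @cvg_harmonic R.
    exists N => k /NP /=; rewrite sub0r normrN ger0_norm// ltW.
  have [N2 N2P] : exists N, forall k l, (N <= k)%N -> (N <= l)%N ->
     \sum_(i < p) (dot (v i) (x (t k)) - dot (v i) (x (t l))) ^+ 2 <= m / 4 * eps.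
    (* Since [eta <= 1], squares of numbers at most [eta] are at most [eta], and [p] of them sum to
       at most [p * eta]. Dividing by [p.+1] keeps [eta] positive when [p = 0]. *)
    pose eta := Num.min 1 (m / 4 * eps / p.+1%:R).
    have e0 : 0 < m / 4 * eps by rewrite mulr_gt0// divr_gt0.
    have eta0 : 0 < eta by rewrite lt_min ltr01 divr_gt0.
    have /choice[M MP] : forall i : nat, exists N, (i < p)%N -> forall k,
        (N <= k)%N -> `|limn (dot (v i) \o (x \o t)) - dot (v i) (x (t k))| <= eta / 2.
      move=> i; have [ip|_] := boolP (i < p)%N; last by exists 0%N.
      have e2 : 0 < eta / 2 by rewrite divr_gt0.
      have /cvgrPdist_le/(_ _ e2)[N _ NP] := tc _ ip.
      by exists N => _ k /NP.
    exists (\max_(i < p) M i)%N => k l Nk Nl.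
    apply: (@le_trans _ _ (\sum_(i < p) eta)).
      apply: ler_sum => i _.
      have Mi : (M i <= \max_(i < p) M i)%N by exact: leq_bigmax.
      have := MP i (ltn_ord i) _ (leq_trans Mi Nk).
      have := MP i (ltn_ord i) _ (leq_trans Mi Nl).
      set L := limn _; set y := dot _ _; set z := dot _ _.
      rewrite !ler_norml => /andP[h1 h2] /andP[h3 h4].
      have eta1 : eta <= 1 by rewrite ge_min lexx.
      have h5 : `|z - y| <= eta by rewrite ler_norml; apply/andP; split; lra.
      rewrite -real_normK ?num_real// expr2 -[leRHS]mulr1.
      by apply: ler_pM => //; exact: le_trans eta1.
    rewrite sumr_const card_ord -[leLHS]mulr_natr.
    have : eta <= m / 4 * eps / p.+1%:R by rewrite ge_min lexx orbT.
    rewrite ler_pdivlMr// => /(le_trans _); apply.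
    by rewrite ler_wpM2l ?ler_nat// ltW.
  exists (maxn N1 N2) => k l; rewrite !geq_max => /andP[k1 k2] /andP[l1 l2] /=.
  have [Wk dk ak] := xP (t k); have [Wl dl al] := xP (t l).
  have := b_diff_le Wk Wl; rewrite {2 3}/b dk dl.
  have := pv (x (t k) - x (t l)).
  under eq_bigr do rewrite (formBr dotQ).
  have := N1P _ (leq_trans k1 (t_ge k)); have := N1P _ (leq_trans l1 (t_ge l)).
  have := N2P _ _ k2 l2.
  rewrite /b; set D := dot (_ - _) _; set A := a (_ - _) _.
  move: m_gt0 ak al; set rk := _^-1; set rl := _^-1.
  set s := \sum_(i < p) _ => m0 *.
  have : m * D <= m * eps by lra.
  by rewrite ler_pM2l.
exists u; split.
- move=> i ni; rewrite form_sym//.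
  have h := cvg_dot_left dotQ (w := e i) xu.
  have h' : dot ((x \o t) k) (e i) @[k --> \oo] --> (0 : R).
    apply: cvg_near_cst; apply: nearW => k /=.
    by rewrite form_sym//; have [-> //] := xP (t k).
  exact: (cvg_unique _ h h').
- have h := cvg_dot_diag dotQ xu.
  have h' : dot ((x \o t) k) ((x \o t) k) @[k --> \oo] --> (1 : R).
    by apply: cvg_near_cst; apply: nearW => k /=; have [] := xP (t k).
  exact: (cvg_unique _ h h').
- have h := cvg_form_diag aQ a_bnd xu.
  have h' : a ((x \o t) k) ((x \o t) k) @[k --> \oo] --> m.
    apply: (@squeeze_cvgr _ _ _ _ (fun k => m - k.+1%:R^-1) (fun=> m)).
    + apply: nearW => k /=; have [Wk dk ak] := xP (t k).
      have := m_max Wk; rewrite dk mulr1 => ->; rewrite andbT.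
      rewrite (le_trans _ (ltW ak))// lerD2l lerN2 lef_pV2 ?posrE//.
      by rewrite ler_nat ltnS t_ge.
    + rewrite -[X in _ --> X]subr0; apply: cvgB; first exact: cvg_cst.
      exact: cvg_harmonic.
    + exact: cvg_cst.
  exact: (cvg_unique _ h h').
Qed.

(** The maximizer is a null vector of [b], which is non-negative on [W], so [b u w = 0] for all [w]
    in [W]. A general [w] is brought into [W] by removing its component [p] along the earlier
    eigenvectors, and [u] is orthogonal to [p] for both forms. *)
Lemma next_eigenvector : exists u, [/\ dot u u = 1, W u, eigenvector a u, 0 < a u u &
  forall v, W v -> a v v <= a u u * dot v v].
Proof.
have [u [Wu u1 am]] := exists_maximizer.
exists u; split => //; [|by rewrite am|by move=> v Wv; rewrite am m_max].
have bW w : W w -> b u w = 0.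
  move=> Ww; apply/eqP; rewrite -[_ == _]negbK; apply/negP => uw.
  have bww := b_ge0 Ww.
  have := b_ge0 (W_lin (- (b w w + 1) / (2 * b u w)) Wu Ww).
  set k := (X in X *: u) => h.
  have bu : b u u = 0 by rewrite /b am u1 mulr1 subrr.
  have kE : 2 * k * b u w = - (b w w + 1) by rewrite /k; field.
  move: h kE bu; rewrite /b !(formDl aQ, formDr aQ, formZl aQ, formZr aQ).
  rewrite !(formDl dotQ, formDr dotQ, formZl dotQ, formZr dotQ).
  rewrite (form_sym aQ w u) (form_sym dotQ w u) => h kE bu.
  have : k ^+ 2 * (m * dot u u - a u u) = 0 by rewrite bu mulr0.
  lra.
move=> w; pose p := \sum_(i < n) dot (e i) w *: e i.
have Wwp : W (w - p).
  move=> i ni; rewrite (formBr dotQ) (form_sym dotQ _ p).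
  by rewrite (dot_sum_orthonormal dotQ (fun i => dot (e i) w) eO)// ni subrr.
have := bW _ Wwp; rewrite /b (formBr dotQ) (formBr aQ).
have -> : dot u p = 0.
  rewrite form_sumr// big1// => i _.
  by rewrite (formZr dotQ) (form_sym dotQ u) Wu// mulr0.
have -> : a u p = 0.
  rewrite (form_sumr aQ) big1// => i _.
  by rewrite (formZr aQ) (form_sym aQ) eE// Wu// !mulr0.
rewrite am; lra.
Qed.

End NextEigenvector.

(** [sb_max] is one half of the min-max principle; monotonicity is a consequence of it, and totality
    follows from it together with [sb_cvg0] and the injectivity of [a]. *)
Record spectral_basis a e : Prop := SpectralBasis {
  sb_orthonormal : orthonormal dot e;
  sb_total : total_family dot e;
  sb_eigen : forall n, eigenvector a (e n);
  sb_gt0 : forall n, 0 < a (e n) (e n);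
  sb_max : forall n v, (forall i, (i < n)%N -> dot (e i) v = 0) ->
    a v v <= a (e n) (e n) * dot v v;
  sb_homo : forall n p, (n <= p)%N -> a (e p) (e p) <= a (e n) (e n);
  sb_cvg0 : forall eps, 0 < eps -> exists n, a (e n) (e n) < eps }.

Theorem spectral_theorem (a : V -> V -> R) (C : R) : psd_form a ->
  form_complete dot -> (forall v, a v v <= C * dot v v) ->
  (forall v, a v v = 0 -> dot v v = 0) -> form_compact a -> infinite_dim ->
  exists e, spectral_basis a e.
Proof.
move=> aQ cpl aC a0 acpt dimV.
pose good n e := orthonormal_upto dot n e /\
  forall i, (i < n)%N -> eigenvector a (e i).
pose step n e u := [/\ dot u u = 1, forall i, (i < n)%N -> dot (e i) u = 0,
  eigenvector a u, 0 < a u u &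
  forall v, (forall i, (i < n)%N -> dot (e i) v = 0) -> a v v <= a u u * dot v v].
(* Choice ranges over all pairs, with [0] as junk value for those that are not good, so that the
   recursion can call a plain function. *)
have /choice[next nextP] : forall ne : nat * (nat -> V), exists u,
    good ne.1 ne.2 -> step ne.1 ne.2 u.
  move=> [n e] /=; have [[eO eE]|ng] := pselect (good n e); last by exists 0.
  by have [u uP] := next_eigenvector aQ cpl aC a0 acpt dimV eO eE; exists u.
(* [E n] is the family after [n] steps. It is meaningful below [n] only, which is all that [good n]
   and [step n] look at. *)
pose E := fix E n := if n is m.+1
  then (fun i => if (i < m)%N then E m i else next (m, E m)) else (fun=> 0).
pose e n := next (n, E n).
have Ee n i : (i < n)%N -> E n i = e i.
  elim: n => // n ih; rewrite ltnS leq_eqVlt /= => /predU1P[->|il].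
    by rewrite ltnn.
  by rewrite il ih.
have goodP n : good n e /\ step n e (e n).
  have good_step m : good m e -> step m e (e m).
    move=> [eO eE]; have [|s1 s2 s3 s4 s5] := nextP (m, E m).
      split => /= [i j im jm|i im]; first by rewrite !Ee// eO.
      by rewrite Ee//; exact: eE.
    split => //= [i im|v ve].
      by rewrite -(Ee m)// s2.
    by apply: s5 => i /= im; rewrite Ee// ve.
  suff : good n e by move=> g; split => //; exact: good_step.
  elim: n => [|n ih]; first by split.
  have [s1 s2 s3 _ _] := good_step _ ih; have [eO eE] := ih.
  split => [i j|i]; last first.
    by rewrite ltnS leq_eqVlt => /predU1P[->//|/eE].
  rewrite ltnS leq_eqVlt => /predU1P[->|im];
    rewrite ltnS leq_eqVlt => /predU1P[->|jm].
  - by rewrite eqxx.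
  - by rewrite form_sym// s2// gtn_eqF.
  - by rewrite s2// ltn_eqF.
  - exact: eO.
have eO : orthonormal dot e.
  move=> i j; have [[h _] _] := goodP (maxn i j).+1.
  by rewrite h// ltnS ?leq_maxl ?leq_maxr.
have emax n v : (forall i, (i < n)%N -> dot (e i) v = 0) ->
    a v v <= a (e n) (e n) * dot v v.
  by have [_ [_ _ _ _ h]] := goodP n; exact: h.
have ehomo n p : (n <= p)%N -> a (e p) (e p) <= a (e n) (e n).
  move=> np; have := emax n (e p); rewrite eO eqxx mulr1; apply => i il.
  by rewrite eO ltn_eqF// (leq_trans il).
(* A trace argument: summing the compactness bound over the first [n] eigenvectors, and applying
   Bessel to each [v i], gives the bound [D] for every [n]. Too many eigenvalues above [eps] would
   exceed it. *)
have ecvg0 eps : 0 < eps -> exists n, a (e n) (e n) < eps.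
  move=> eps0; have [|m [v mv]] := acpt (eps / 2); first by rewrite divr_gt0.
  pose D := \sum_(i < m) dot (v i) (v i).
  have D0 : 0 <= D by apply: sumr_ge0 => i _; exact: form_ge0.
  have key n : \sum_(k < n) (a (e k) (e k) - eps / 2) <= D.
    apply: (@le_trans _ _ (\sum_(k < n) \sum_(i < m) dot (v i) (e k) ^+ 2)).
      apply: ler_sum => k _.
      by have := mv (e k); rewrite eO eqxx mulr1; lra.
    rewrite exchange_big; apply: ler_sum => i _ /=.
    have eOn : orthonormal_upto dot n e by move=> ? ? _ _; exact: eO.
    apply: le_trans (bessel dotQ (v i) eOn).
    by apply: ler_sum => k _; rewrite form_sym.
  pose n := (Num.truncn (D / (eps / 2))).+1.
  exists n; rewrite ltNge; apply/negP => an.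
  have := key n; rewrite leNgt => /negP; apply.
  apply: (@lt_le_trans _ _ (\sum_(k < n) eps / 2)); last first.
    apply: ler_sum => k _; have := ehomo _ _ (ltnW (ltn_ord k)); lra.
  rewrite sumr_const card_ord -[ltRHS]mulr_natl -ltr_pdivrMr ?divr_gt0//.
  by rewrite truncnS_gt.
exists e; split => //.
(* A vector orthogonal to the whole family satisfies the bound of [emax] for every [n]; as the
   eigenvalues get arbitrarily small, [a v v = 0]. *)
- move=> v ve; apply: a0; apply/eqP; rewrite eq_le form_ge0// andbT leNgt.
  apply/negP => av0.
  have v0 : 0 <= dot v v := form_ge0 dotQ v.
  have [n] := ecvg0 (a v v / (dot v v + 1)) (divr_gt0 av0 (ltr_wpDl v0 ltr01)).
  rewrite ltr_pdivlMr ?ltr_wpDl// ltNge => /negP; apply.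
  have := emax n v (fun i _ => ve i).
  have := form_ge0 aQ (e n); nra.
- by move=> n; have [_ []] := goodP n.
- by move=> n; have [_ []] := goodP n.
Qed.

(** * Min-max comparison of eigenvalues *)

Lemma homogeneous_system_solution (n : nat) (M : nat -> nat -> R) :
  exists2 c : nat -> R, exists2 i, (i < n.+1)%N & c i != 0 &
    forall j, (j < n)%N -> \sum_(i < n.+1) c i * M i j = 0.
Proof.
pose A : 'M[R]_(n.+1, n) := \matrix_(i, j) M i j.
have : kermx A != 0.
  rewrite -mxrank_eq0 mxrank_ker subn_eq0 -ltnNge ltnS.
  exact: rank_leq_col.
case/rowV0Pn => r /sub_kermxP rA r0.
exists (fun i => if insub i is Some k then r 0 k else 0).
  have [i ri] : exists i, r 0 i != 0.
    apply/existsP; apply: contraR r0 => /existsPn h.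
    by apply/eqP/rowP => i; rewrite mxE; apply/eqP; rewrite -[_ == _]negbK h.
  by exists i => //; rewrite valK.
move=> j jn; have /rowP/(_ (Ordinal jn)) := rA; rewrite !mxE => h; rewrite -[RHS]h.
by apply: eq_bigr => i _; rewrite valK mxE.
Qed.

(* Some nonzero combination of the first [n.+1] eigenvectors of [a] is mapped by
   [T] to a vector orthogonal to the first [n] eigenvectors of [a']. *)
Lemma eigenvalue_comparison a a' e e' (T : {linear V -> V}) (s t : R) :
  psd_form a -> 0 <= s ->
  spectral_basis a e -> spectral_basis a' e' ->
  (forall v, a v v <= s * a' (T v) (T v)) ->
  (forall v, dot (T v) (T v) <= t * dot v v) ->
  forall n, a (e n) (e n) <= s * t * a' (e' n) (e' n).
Proof.
move=> aQ s0 eS eS' aT dT n.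
have [c [k kn ck0] cP] :=
  homogeneous_system_solution n (fun i j => dot (e' j) (T (e i))).
have eO : orthonormal_upto dot n.+1 e by move=> ? ? _ _; exact: (sb_orthonormal eS).
set v := \sum_(i < n.+1) c i *: e i.
have vv : dot v v = \sum_(i < n.+1) c i ^+ 2 by exact: (dot_sum_sqr dotQ c eO).
have v0 : 0 < dot v v.
  rewrite vv (bigD1 (Ordinal kn))//= ltr_pwDl//; last first.
    by apply: sumr_ge0 => i _; exact: sqr_ge0.
  by rewrite lt_neqAle eq_sym sqrf_eq0 ck0 sqr_ge0.
(* On the span of the first [n.+1] eigenvectors [a] is diagonal, with entries at least
   [a (e n) (e n)]. *)
have av : a (e n) (e n) * dot v v <= a v v.
  have -> : a v v = \sum_(i < n.+1) c i * a (e i) v.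
    by rewrite {1}/v (form_suml aQ); apply: eq_bigr => i _; rewrite (formZl aQ).
  rewrite vv mulr_sumr; apply: ler_sum => i _.
  rewrite (sb_eigen eS i v) (form_sym dotQ (e i)).
  rewrite (dot_sum_orthonormal dotQ c eO)// ltn_ord.
  have := sb_homo eS (n := i) (p := n); rewrite -ltnS ltn_ord => /(_ isT).
  have := sqr_ge0 (c i); nra.
have Tv : a' (T v) (T v) <= a' (e' n) (e' n) * dot (T v) (T v).
  apply: (sb_max eS') => j jn; rewrite linear_sum/= form_sumr//.
  rewrite -[RHS](cP j jn); apply: eq_bigr => i _.
  by rewrite linearZ/= (formZr dotQ).
rewrite -(ler_pM2r v0) (le_trans av)// (le_trans (aT v))//.
rewrite -!mulrA ler_wpM2l// (le_trans Tv)// mulrCA [leRHS]mulrC.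
by rewrite (mulrC _ (dot _ _)) ler_wpM2r ?dT// ltW// (sb_gt0 eS').
Qed.

End Spectral.

(** * Completeness of L^2 *)

Section SquareIntegrable.
Context d {T : measurableType d} {R : realType}.
Variable mu : {measure set T -> \bar R}.
Implicit Types f g h : T -> R.

(** Taken over the whole space: functions on the half-line will be extended by zero, so that Tonelli
    and Fubini apply without restricted integrals. *)
Definition sqint f : Prop :=
  measurable_fun setT f /\ mu.-integrable setT (EFin \o (fun x => f x ^+ 2)).

Lemma sqintP f : measurable_fun setT f ->
  (\int[mu]_x (f x ^+ 2)%:E < +oo)%E -> sqint f.
Proof.
move=> mf foo; split=> //; apply/integrableP; split.
  by apply/measurable_EFinP; exact: measurable_funX.
by under eq_integral => x _ do rewrite gee0_abs ?lee_fin ?sqr_ge0//.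
Qed.

Lemma le_sqint f g : measurable_fun setT f ->
  (forall x, `|f x| <= `|g x|) -> sqint g -> sqint f.
Proof.
move=> mf fg [mg ig]; split => //; apply: le_integrable ig => //.
  by apply/measurable_EFinP; exact: measurable_funX.
by move=> x _ /=; rewrite lee_fin !normrX ler_pXn2r// nnegrE.
Qed.

Lemma sqint_mul f g : sqint f -> sqint g ->
  mu.-integrable setT (EFin \o (fun x => f x * g x)).
Proof.
move=> [mf If] [mg ig].
apply: (@le_integrable _ _ _ _ _ _ _ (fun x => (f x ^+ 2)%:E + (g x ^+ 2)%:E)%E) => //.
- by apply/measurable_EFinP; exact: measurable_funM.
- move=> x _ /=; rewrite lee_fin normrM.
  rewrite (ger0_norm (addr_ge0 (sqr_ge0 _) (sqr_ge0 _))).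
  rewrite -(real_normK (num_real (f x))) -(real_normK (num_real (g x))).
  by have := sqr_ge0 (`|f x| - `|g x|); have := sqr_ge0 (`|f x| + `|g x|); nra.
- exact: integrableD.
Qed.

Lemma sqintZ k f : sqint f -> sqint (fun x => k * f x).
Proof.
move=> [mf If]; split; first exact: measurable_funM.
have := integrableZl measurableT (k ^+ 2) If.
apply: eq_integrable => // x _ /=.
by rewrite -EFinM exprMn.
Qed.

Lemma sqintD f g : sqint f -> sqint g -> sqint (fun x => f x + g x).
Proof.
move=> sf sg; have fg := sqint_mul sf sg; case: sf sg => [mf If] [mg ig].
split; first exact: measurable_funD.
have := integrableD measurableT (integrableD measurableT If ig)
  (integrableZl measurableT 2 fg).
apply: eq_integrable => // x _ /=.
by rewrite -EFinM -!EFinD; congr EFin; ring.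
Qed.

Lemma sqintB f g : sqint f -> sqint g -> sqint (fun x => f x - g x).
Proof.
move=> sf sg.
rewrite (_ : (fun x => _) = (fun x => f x + -1 * g x)); last first.
  by apply/funext => x; rewrite mulN1r.
by apply: sqintD => //; exact: sqintZ.
Qed.

Lemma sqint0 : sqint (fun=> 0).
Proof.
by split=> //; rewrite (_ : _ \o _ = cst 0%E);
  [exact: integrable0|apply/funext => x /=; rewrite expr0n].
Qed.

Lemma Rintegral_sqr f : sqint f ->
  (\int[mu]_x (f x ^+ 2)%:E = (\int[mu]_x (f x ^+ 2))%:E)%E.
Proof. by move=> [mf If]; rewrite fineK// integrable_fin_num. Qed.

Lemma Rintegral_sqr_eq0 f : sqint f -> \int[mu]_x (f x ^+ 2) = 0 ->
  ae_eq mu setT f (fun=> 0).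
Proof.
move=> sf f0; have [mf If] := sf.
have : (\int[mu]_x `|(f x ^+ 2)%:E| = 0)%E.
  under eq_integral => x _ do rewrite gee0_abs ?lee_fin ?sqr_ge0//.
  by rewrite Rintegral_sqr// f0.
move/(ae_eq_integral_abs _ measurableT); move=> /(_ _).
case; first by apply/measurable_EFinP; exact: measurable_funX.
move=> N [mN N0 fN]; exists N; split => // x xN; apply: fN => /= h; apply: xN => /= _.
by have [/eqP] := h I; rewrite sqrf_eq0 => /eqP.
Qed.

Lemma ae_eq_Rintegral f g : measurable_fun setT f -> measurable_fun setT g ->
  ae_eq mu setT f g -> \int[mu]_x f x = \int[mu]_x g x.
Proof.
move=> mf mg fg; congr fine; apply: ae_eq_integral => //; try exact/measurable_EFinP.
by apply: filterS fg => x h Dx; rewrite h.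
Qed.

(* Fatou's lemma applied to a subsequence along which the increments are
   summable, which converges almost everywhere. *)
Theorem sqint_complete (f : nat -> T -> R) : (forall n, sqint (f n)) ->
  (forall eps, 0 < eps -> exists N, forall k l, (N <= k)%N -> (N <= l)%N ->
     \int[mu]_x (f k x - f l x) ^+ 2 <= eps) ->
  exists2 g, sqint g &
    forall eps, 0 < eps -> exists N, forall k, (N <= k)%N ->
      sqint (fun x => f k x - g x) /\ \int[mu]_x (f k x - g x) ^+ 2 <= eps.
Proof.
move=> sf cf.
have mf n : measurable_fun setT (f n) by case: (sf n).
(* With weights [4 ^+ j] the squared increments still have the summable integrals [1 / 2 ^ j.+1],
   and wherever [S x] is finite the increments decay geometrically. *)
pose e j : R := (4 ^+ j)^-1 * (1 / (2 ^ j.+1)%:R).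
have e0 j : 0 < e j by rewrite mulr_gt0// ?invr_gt0 ?exprn_gt0// divr_gt0 ?ltr0n ?expn_gt0.
have /choice[M MP] := fun j => cf (e j) (e0 j).
pose t := fix t j := if j is i.+1 then maxn (t i).+1 (M j) else M 0%N.
have tM j : (M j <= t j)%N by case: j => //= j; rewrite leq_maxr.
have t_homo : {homo t : i j / (i <= j)%N}.
  apply: homo_leq => [//|? ? ?|i]; first exact: leq_trans.
  by rewrite /= (leq_trans (leqnSn _)) ?leq_maxl.
have t_ge j : (j <= t j)%N.
  by elim: j => // j ih; rewrite /= (leq_trans _ (leq_maxl _ _)).
pose h j x := f (t j.+1) x - f (t j) x.
have sh j : sqint (h j) by exact: sqintB.
have mh j : measurable_fun setT (h j) by case: (sh j).
pose S x := (\sum_(j <oo) (4 ^+ j * h j x ^+ 2)%:E)%E.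
have h0 j x : (0 <= (4 ^+ j * h j x ^+ 2)%:E)%E.
  by rewrite lee_fin mulr_ge0 ?sqr_ge0// exprn_ge0.
have mhE j : measurable_fun setT (fun x => (4 ^+ j * h j x ^+ 2)%:E).
  by apply/measurable_EFinP; apply: measurable_funM => //; exact: measurable_funX.
have mhsq j : measurable_fun setT (fun x => (h j x ^+ 2)%:E).
  by apply/measurable_EFinP; exact: measurable_funX.
have mS : measurable_fun setT S.
  by apply: ge0_emeasurable_sum.
have Soo : (\int[mu]_x S x < +oo)%E.
  rewrite integral_nneseries//.
  apply: (@le_lt_trans _ _ 1%:E); last exact: ltry.
  apply: le_trans (@epsilon_trick0 _ 1 xpredT ler01).
  apply: lee_nneseries => [j _ _|j _]; first exact: integral_ge0.
  under eq_integral do rewrite EFinM.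
  rewrite (ge0_integralZl _ measurableT (mhsq j)) ?lee_fin ?exprn_ge0//; last first.
    by move=> x _; rewrite lee_fin sqr_ge0.
  rewrite Rintegral_sqr// -EFinM lee_fin.
  have := MP j (t j.+1) (t j) (leq_trans (tM _) (t_homo _ _ (leqnSn _))) (tM _).
  by rewrite /e ler_pdivlMl// exprn_gt0.
have S0 x : (0 <= S x)%E by exact: nneseries_ge0.
have Sfin : {ae mu, forall x, setT x -> S x \is a fin_num}.
  apply: integrable_ae => //; apply/integrableP; split => //.
  by under eq_integral do rewrite gee0_abs//.
pose E := [set x | S x \is a fin_num].
have mE : measurable E.
  have := emeasurable_fin_num measurableT mS; by rewrite setTI.
(* Cutting off the null set where [S] is infinite makes the sequence converge at every point, so
   that its limit [g] is measurable. *)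
pose F j x := f (t j) x * \1_E x.
have mF j : measurable_fun setT (F j) by exact: measurable_funM.
have Fcv x : cvgn (F ^~ x).
  have [xE|xE] := pselect (E x); last first.
    rewrite (_ : F ^~ x = fun=> 0); first exact: is_cvg_cst.
    by apply/funext => j; rewrite /F indicE memNset// mulr0.
  have hS j : h j x ^+ 2 <= fine (S x) / 4 ^+ j.
    rewrite ler_pdivlMr ?exprn_gt0// mulrC -lee_fin fineK//.
    have := nneseries_lim_ge j.+1 (fun n _ _ => h0 n x).
    move=> /(_ xpredT 0%N); apply: le_trans; rewrite big_nat_recr//= leeDr//.
    by apply: sume_ge0 => i _; exact: h0.
  (* [fine (S x) + 1] replaces the square root of [fine (S x)], which it dominates. *)
  have hg j : `|h j x| <= geometric (fine (S x) + 1) (2^-1) j.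
    have S1 : 0 <= fine (S x) by rewrite fine_ge0.
    rewrite -(@ler_pXn2r _ 2)//; last first.
      by rewrite nnegrE /= mulr_ge0 ?addr_ge0// exprn_ge0.
    rewrite real_normK ?num_real// (le_trans (hS j))//= exprMn exprAC.
    rewrite (_ : 2^-1 ^+ 2 = 4^-1 :> R); last by field.
    rewrite exprVn ler_wpM2r ?invr_ge0 ?exprn_ge0//; nra.
  have hc : cvgn (series (h ^~ x)).
    apply: normed_cvg; apply: series_le_cvg hg _ => [j|j|].
    - exact: normr_ge0.
    - by rewrite /= mulr_ge0 ?exprn_ge0 ?addr_ge0 ?fine_ge0.
    - by apply: is_cvg_geometric_series; rewrite ger0_norm// invf_lt1// ltr1n.
  rewrite (_ : F ^~ x = fun j => f (t 0%N) x + series (h ^~ x) j).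
    by apply: is_cvgD => //; exact: is_cvg_cst.
  apply/funext => j; rewrite /F indicE mem_set// mulr1 /series /=.
  by rewrite /h telescope_sumr// addrC subrK.
pose g x := limn (F ^~ x).
have mg : measurable_fun setT g.
  by apply: (@measurable_fun_cvg _ _ _ _ F) => // x _; exact: Fcv.
have bound eps k : (exists N, forall l, (N <= l)%N -> \int[mu]_x (f k x - f l x) ^+ 2 <= eps) ->
    (\int[mu]_x ((f k x - g x) ^+ 2)%:E <= eps%:E)%E.
  move=> [N NP].
  have -> : (\int[mu]_x ((f k x - g x) ^+ 2)%:E =
      \int[mu]_x limn_einf (fun j => ((f k x - F j x) ^+ 2)%:E))%E.
    apply: eq_integral => x _; apply/esym.
    apply: (cvg_limn_einf_sup _).1; apply/cvg_EFin; first exact: nearW.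
    have hd : f k x - F j x @[j --> \oo] --> f k x - g x.
      by apply: cvgB; [exact: cvg_cst|exact: Fcv].
    by under eq_fun do rewrite expr2/=; rewrite expr2; apply: cvgM; exact: hd.
  apply: le_trans (fatou _ _ _ _) _ => //.
  - by move=> j; apply/measurable_EFinP/measurable_funX; exact: measurable_funB.
  - by move=> j x _; rewrite lee_fin sqr_ge0.
  rewrite limn_einf_lim; apply: lime_le; first exact: is_cvg_einfs.
  exists N => // j /= Nj; apply: (@le_trans _ _ (\int[mu]_x ((f k x - F j x) ^+ 2)%:E)%E).
    by apply: ereal_inf_lbound; exists j => /=.
  have skj : sqint (fun x => f k x - f (t j) x) by exact: sqintB.
  apply: le_trans (_ : (\int[mu]_x ((f k x - f (t j) x) ^+ 2)%:E <= eps%:E)%E); last first.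
    by rewrite Rintegral_sqr// lee_fin NP// (leq_trans Nj).
  rewrite le_eqVlt; apply/orP; left; apply/eqP; apply: ge0_ae_eq_integral => //.
  - by apply/measurable_EFinP/measurable_funX; exact: measurable_funB.
  - by apply/measurable_EFinP/measurable_funX; exact: measurable_funB.
  - by move=> x _; rewrite lee_fin sqr_ge0.
  - by move=> x _; rewrite lee_fin sqr_ge0.
  - apply: filterS Sfin => x /(_ I) xE _; rewrite /F indicE mem_set// mulr1//.
have sg : sqint g.
  have [N NP] := cf _ ltr01.
  have sk : sqint (fun x => f N x - g x).
    apply: sqintP; first exact: measurable_funB.
    apply: le_lt_trans (bound 1 N _) (ltry _); exists N => l Nl; exact: NP.
  rewrite (_ : g = fun x => f N x - (f N x - g x)); first exact: sqintB.
  by apply/funext => x; rewrite subKr.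
exists g => // eps eps0; have [N NP] := cf _ eps0.
exists N => k Nk; have sk : sqint (fun x => f k x - g x) by exact: sqintB.
split => //; rewrite -lee_fin -Rintegral_sqr//; apply: bound; exists N => l Nl.
exact: NP.
Qed.

End SquareIntegrable.

(** * The Schur test *)

Section EFinIntegrable.
Context d {T : measurableType d} {R : realType}.
Variable mu : {measure set T -> \bar R}.
Implicit Types f g : T -> R.

Lemma integrable_EFinZl k f : mu.-integrable setT (EFin \o f) ->
  mu.-integrable setT (EFin \o (fun x => k * f x)).
Proof.
by move=> /(integrableZl measurableT k); apply: eq_integrable.
Qed.

Lemma integrable_EFinD f g : mu.-integrable setT (EFin \o f) ->
  mu.-integrable setT (EFin \o g) ->
  mu.-integrable setT (EFin \o (fun x => f x + g x)).
Proof.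
by move=> If ig; have := integrableD measurableT If ig; apply: eq_integrable.
Qed.

Lemma Rintegral_sum (m : nat) (F : nat -> T -> R) :
  (forall j, mu.-integrable setT (EFin \o F j)) ->
  mu.-integrable setT (EFin \o (fun x => \sum_(j < m) F j x)) /\
  \int[mu]_x (\sum_(j < m) F j x) = \sum_(j < m) \int[mu]_x F j x.
Proof.
move=> iF; elim: m => [|m [ih1 ih2]].
  rewrite big_ord0; split.
    rewrite (_ : _ \o _ = cst 0%E); first exact: integrable0.
    by apply/funext => x /=; rewrite big_ord0.
  rewrite /Rintegral (_ : (fun x => _) = cst 0%E) ?integral0//.
  by apply/funext => x /=; rewrite big_ord0.
rewrite big_ord_recr /= -ih2 -RintegralD//.
have E : (fun x => \sum_(j < m.+1) F j x) = fun x => \sum_(j < m) F j x + F m x.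
  by apply/funext => x; rewrite big_ord_recr.
by rewrite E; split => //; exact: integrable_EFinD.
Qed.

End EFinIntegrable.

Section SchurTest.
Context {R : realType}.
Notation mu := (@lebesgue_measure R).
Implicit Types (f g : R -> R) (k : R -> R -> R).

(** The uniform bound [C] turns integrable rows into square-integrable ones, so that
    [kernel_op k f x] is a convergent integral at every [x] and not just at almost every one. *)
Record schur_kernel k (A B C : R) : Prop := SchurKernel {
  schur_meas : measurable_fun setT (fun z : R * R => k z.1 z.2);
  schur_ge0 : forall x y, 0 <= k x y;
  schur_le : forall x y, k x y <= C;
  schur_row : forall x, (\int[mu]_y (k x y)%:E <= A%:E)%E;
  schur_col : forall y, (\int[mu]_x (k x y)%:E <= B%:E)%E }.

Definition kernel_op k f x : R := \int[mu]_y (k x y * f y).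

Lemma schur_kernelC k A B C : schur_kernel k A B C ->
  schur_kernel (fun x y => k y x) B A C.
Proof.
case=> mk k0 kC kr kc; split => //.
exact: (measurableT_comp mk (measurable_fun_pair measurable_snd measurable_fst)).
Qed.

Context k (A B C : R) (kS : schur_kernel k A B C).

Lemma schur_measurable_row x : measurable_fun setT (k x).
Proof. exact: (measurableT_comp (schur_meas kS) (pair1_measurable x)). Qed.

Lemma schur_integrable_row x : mu.-integrable setT (EFin \o k x).
Proof.
apply/integrableP; split.
  by apply/measurable_EFinP; exact: schur_measurable_row.
under eq_integral => y _ do rewrite gee0_abs ?lee_fin ?(schur_ge0 kS)//.
exact: le_lt_trans (schur_row kS x) (ltry _).
Qed.

Lemma schur_sqint_row x : sqint mu (k x).
Proof.
have mk := schur_measurable_row x; split => //.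
have := integrableZl measurableT C (schur_integrable_row x).
apply: le_integrable => //.
  by apply/measurable_EFinP; exact: measurable_funX.
move=> y _ /=; rewrite lee_fin expr2 !normrM ler_wpM2r//.
rewrite ger0_norm ?(schur_ge0 kS)//.
exact: le_trans (schur_le kS x y) (ler_norm _).
Qed.

Lemma schur_integrable f x : sqint mu f ->
  mu.-integrable setT (EFin \o (fun y => k x y * f y)).
Proof. by apply: sqint_mul; exact: schur_sqint_row. Qed.

Lemma kernel_op_measurable f : measurable_fun setT f ->
  measurable_fun setT (kernel_op k f).
Proof.
move=> mf; pose F (z : R * R) := (k z.1 z.2 * f z.2)%:E.
have mF : measurable_fun setT F.
  apply/measurable_EFinP; apply: measurable_funM; first exact: (schur_meas kS).
  exact: (measurableT_comp mf measurable_snd).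
apply: (measurableT_comp (f := fine)) => //.
rewrite (_ : (fun x => _) = (fun x => (\int[mu]_y F^\+ (x, y) - \int[mu]_y F^\- (x, y))%E)).
  apply: emeasurable_funB.
  - have := @measurable_fun_fubini_tonelli_F _ _ _ _ R mu (F^\+)%E.
    by apply => //; exact: measurable_funepos.
  - have := @measurable_fun_fubini_tonelli_F _ _ _ _ R mu (F^\-)%E.
    by apply => //; exact: measurable_funeneg.
apply/funext => x; rewrite [LHS]integralE.
by congr (_ - _)%E; apply: eq_integral => y _; rewrite ?funeposE ?funenegE.
Qed.

(** Cauchy-Schwarz for the measure [k x y dy], of mass at most [A]. It is read off from the integral
    of [k x y * (f y - t) ^+ 2], which is non-negative, at [t = F / A]. *)
Let sqr_le f x : sqint mu f -> 0 < A ->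
  (((kernel_op k f x) ^+ 2)%:E <= A%:E * \int[mu]_y (k x y * f y ^+ 2)%:E)%E.
Proof.
move=> sf A0; have [mf _] := sf.
have mk := schur_measurable_row x.
have mkf : measurable_fun setT (fun y => (k x y * f y ^+ 2)%:E).
  by apply/measurable_EFinP; apply: measurable_funM => //; exact: measurable_funX.
have kf0 y : (0 <= (k x y * f y ^+ 2)%:E)%E.
  by rewrite lee_fin mulr_ge0 ?sqr_ge0 ?(schur_ge0 kS).
have [Ioo|Ioo] := ltP (\int[mu]_y (k x y * f y ^+ 2)%:E)%E +oo%E; last first.
  have /eqP -> : (\int[mu]_y (k x y * f y ^+ 2)%:E == +oo)%E by rewrite -leye_eq.
  by rewrite gt0_muley ?leey.
have ikf : mu.-integrable setT (EFin \o (fun y => k x y * f y ^+ 2)).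
  apply/integrableP; split => //.
  by under eq_integral => y _ do rewrite /= ger0_norm -?lee_fin ?kf0//.
have ik := schur_integrable_row x; have i1 := schur_integrable x sf.
set F := kernel_op k f x.
have -> : (\int[mu]_y (k x y * f y ^+ 2)%:E = (\int[mu]_y (k x y * f y ^+ 2))%:E)%E.
  by rewrite fineK// integrable_fin_num.
set I := \int[mu]_y _; rewrite -EFinM lee_fin.
set t := F / A.
have : 0 <= \int[mu]_y (k x y * (f y - t) ^+ 2).
  by apply: Rintegral_ge0 => y _; rewrite mulr_ge0 ?sqr_ge0 ?(schur_ge0 kS).
have -> : \int[mu]_y (k x y * (f y - t) ^+ 2) =
    I + - (2 * t) * F + t ^+ 2 * \int[mu]_y k x y.
  rewrite -(RintegralZl (- (2 * t)) measurableT i1) -(RintegralZl _ measurableT ik).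
  rewrite -RintegralD//; last exact: integrable_EFinZl.
  rewrite -RintegralD//; [|exact: integrable_EFinD (integrable_EFinZl _ _)|
    exact: integrable_EFinZl].
  by apply: eq_Rintegral => y _; ring.
have KA : \int[mu]_y k x y <= A.
  have := schur_row kS x; rewrite -lee_fin fineK//; exact: integrable_fin_num.
move: KA; set K := \int[mu]_y k x y => KA.
have tA : t * A = F by rewrite /t mulfVK// gt_eqF.
have t2 : 0 <= t ^+ 2 := sqr_ge0 t.
have : t ^+ 2 * K <= t ^+ 2 * A by rewrite ler_wpM2l.
move=> h1 h2; rewrite -tA; rewrite -tA in h2.
have : t ^+ 2 * A <= I by nra.
nra.
Qed.

(** Integrate [sqr_le] in [x] and exchange the integrals by Tonelli: the rows account for [A], the
    columns for [B]. Working with extended reals makes the finiteness part of the conclusion. *)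
Lemma schur_test f : 0 < A -> sqint mu f ->
  sqint mu (kernel_op k f) /\
  \int[mu]_x (kernel_op k f x) ^+ 2 <= A * B * \int[mu]_x (f x) ^+ 2.
Proof.
move=> A0 sf; have [mf If] := sf.
have mT := kernel_op_measurable mf.
have mT2 : measurable_fun setT (fun x => (kernel_op k f x ^+ 2)%:E).
  by apply/measurable_EFinP; exact: measurable_funX.
have mF : measurable_fun setT (fun z : R * R => (k z.1 z.2 * f z.2 ^+ 2)%:E).
  apply/measurable_EFinP; apply: measurable_funM; first exact: (schur_meas kS).
  by apply: measurable_funX; exact: (measurableT_comp mf measurable_snd).
have F0 (z : R * R) : (0 <= (k z.1 z.2 * f z.2 ^+ 2)%:E)%E.
  by rewrite lee_fin mulr_ge0 ?sqr_ge0 ?(schur_ge0 kS).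
have B0 : 0 <= B.
  rewrite -lee_fin; apply: le_trans (schur_col kS 0).
  by apply: integral_ge0 => x _; rewrite lee_fin (schur_ge0 kS).
have mI1 : measurable_fun setT (fun x => \int[mu]_y (k x y * f y ^+ 2)%:E)%E.
  by have := @measurable_fun_fubini_tonelli_F _ _ _ _ R mu _ mF F0; apply.
have mI2 : measurable_fun setT (fun y => \int[mu]_x (k x y * f y ^+ 2)%:E)%E.
  by have := @measurable_fun_fubini_tonelli_G _ _ _ _ R mu _ mF F0; apply.
have mIE : (\int[mu]_x \int[mu]_y (k x y * f y ^+ 2)%:E =
            \int[mu]_y \int[mu]_x (k x y * f y ^+ 2)%:E)%E.
  exact: (@fubini_tonelli _ _ _ _ R mu mu _ mF F0).
have main : (\int[mu]_x (kernel_op k f x ^+ 2)%:E <=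
    (A * B * \int[mu]_x (f x) ^+ 2)%:E)%E.
  apply: (@le_trans _ _ (\int[mu]_x (A%:E * \int[mu]_y (k x y * f y ^+ 2)%:E))%E).
    apply: ge0_le_integral => //.
    - by move=> x _; rewrite lee_fin sqr_ge0.
    - exact: measurable_funeM.
    - by move=> x _; exact: sqr_le.
  rewrite (_ : \int[mu]_x _ = A%:E * \int[mu]_x \int[mu]_y (k x y * f y ^+ 2)%:E)%E;
      last first.
    apply: (ge0_integralZl mu measurableT mI1); last by rewrite lee_fin ltW.
    by move=> x _; apply: integral_ge0 => y _; exact: (F0 (x, y)).
  rewrite -mulrA EFinM lee_pmul2l//.
  rewrite mIE.
  have mf2 : measurable_fun setT (fun x => (f x ^+ 2)%:E).
    by apply/measurable_EFinP; exact: measurable_funX.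
  rewrite EFinM -Rintegral_sqr//.
  rewrite -(_ : \int[mu]_x (B%:E * (f x ^+ 2)%:E) =
      B%:E * \int[mu]_x (f x ^+ 2)%:E)%E; last first.
    apply: (ge0_integralZl mu measurableT mf2); last by rewrite lee_fin.
    by move=> x _; rewrite lee_fin sqr_ge0.
  apply: ge0_le_integral => //.
  - by move=> y _; apply: integral_ge0 => x _; exact: (F0 (x, y)).
  - exact: (measurable_funeM B%:E mf2).
  - move=> y _; under eq_integral do rewrite mulrC EFinM.
    have mky : measurable_fun setT (fun x => (k x y)%:E).
      apply/measurable_EFinP.
      exact: (measurableT_comp (schur_meas kS) (pair2_measurable y)).
    rewrite (_ : \int[mu]_x _ = (f y ^+ 2)%:E * \int[mu]_x (k x y)%:E)%E; last first.
      apply: (ge0_integralZl mu measurableT mky); last by rewrite lee_fin sqr_ge0.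
      by move=> x _; rewrite lee_fin (schur_ge0 kS).
    by rewrite muleC lee_wpmul2r ?lee_fin ?sqr_ge0// (schur_col kS).
have sT : sqint mu (kernel_op k f).
  by apply: sqintP => //; exact: le_lt_trans main (ltry _).
by split => //; rewrite -lee_fin -Rintegral_sqr.
Qed.

End SchurTest.

Section SchurAdjoint.
Context {R : realType}.
Notation mu := (@lebesgue_measure R).
Implicit Types (f g : R -> R) (k : R -> R -> R).

Lemma kernel_op_adjoint k A B C f g : schur_kernel k A B C -> 0 < A ->
  sqint mu f -> sqint mu g ->
  \int[mu]_x (kernel_op k f x * g x) =
  \int[mu]_y (f y * kernel_op (fun x y => k y x) g y).
Proof.
move=> kS A0 sf sg; have [mf _] := sf; have [mg _] := sg.
have kS' := schur_kernelC kS.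
pose F (z : R * R) := (k z.1 z.2 * f z.2 * g z.1)%:E.
have mF : measurable_fun setT F.
  apply/measurable_EFinP; apply: measurable_funM.
    apply: measurable_funM; first exact: (schur_meas kS).
    exact: (measurableT_comp mf measurable_snd).
  exact: (measurableT_comp mg measurable_fst).
(* Absolute integrability: as [k] is non-negative, the Schur test applied to [|f|] gives a
   square-integrable function, which is paired with [|g|]. *)
have iF : (mu \x mu)%E.-integrable setT F.
  have saf : sqint mu (fun y => `|f y|).
    by apply: le_sqint sf => [|x]; [exact: measurableT_comp|rewrite normr_id].
  have sag : sqint mu (fun y => `|g y|).
    by apply: le_sqint sg => [|x]; [exact: measurableT_comp|rewrite normr_id].
  apply/integrable12ltyP => //.
  have [sT _] := schur_test kS A0 saf.
  have /integrableP[_] := sqint_mul sT sag.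
  congr (_ < _)%E; apply: eq_integral => x _.
  rewrite /= ger0_norm; last first.
    rewrite mulr_ge0//; apply: Rintegral_ge0 => y _.
    by rewrite mulr_ge0 ?(schur_ge0 kS).
  have i1 := schur_integrable kS x saf.
  rewrite EFinM fineK ?integrable_fin_num// -(integralZr measurableT i1).
  apply: eq_integral => y _; rewrite /F /= !normrM -EFinM.
  by rewrite (ger0_norm (schur_ge0 kS _ _)).
rewrite /Rintegral; have := Fubini iF; rewrite /F /= => FE.
transitivity (fine (\int[mu]_x \int[mu]_y F (x, y))).
  congr fine; apply: eq_integral => x _.
  have i1 := schur_integrable kS x sf.
  under eq_integral => y _ do rewrite /F /= EFinM.
  rewrite (integralZr measurableT i1) EFinM fineK//.
  exact: integrable_fin_num.
rewrite /F /= FE; congr fine; apply: eq_integral => y _.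
have i1 := schur_integrable kS' y sg.
under eq_integral => x _ do rewrite mulrAC mulrC EFinM.
rewrite (integralZl measurableT i1) EFinM fineK//.
exact: integrable_fin_num.
Qed.
End SchurAdjoint.

(** * The real space L^2(0, +oo) *)

Section HalfLineL2.
Context {R : realType}.
Notation mu := (@lebesgue_measure R).

(** Genuine functions, so that the module structure is inherited from [R -> R]; almost everywhere
    equal ones differ by a null vector of [hl2_dot]. *)
Definition hl2_pred : {pred R -> R} :=
  [pred f | `[< sqint mu f /\ forall x, x <= 0 -> f x = 0 >]].

Record hl2 := Hl2 { hl2_val :> R -> R; _ : hl2_val \in hl2_pred }.

HB.instance Definition _ := [isSub for hl2_val].
HB.instance Definition _ := [Choice of hl2 by <:].

Lemma hl2_predP f :
  reflect (sqint mu f /\ forall x, x <= 0 -> f x = 0) (f \in hl2_pred).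
Proof. exact: asboolP. Qed.

Lemma hl2_submod_closed : submod_closed hl2_pred.
Proof.
split.
  by apply/hl2_predP; split=> [|//]; exact: sqint0.
move=> a f g => /hl2_predP[sf f0] /hl2_predP[sg g0].
apply/hl2_predP; split; first exact: sqintD (sqintZ _ _) _.
by move=> x x0; rewrite !fctE f0// g0// scaler0 addr0.
Qed.

HB.instance Definition _ := GRing.isSubmodClosed.Build _ _ hl2_pred
  hl2_submod_closed.
HB.instance Definition _ := [SubChoice_isSubLmodule of hl2 by <:].

Lemma hl2_sqint (f : hl2) : sqint mu f.
Proof. by case: f => f /= /hl2_predP[]. Qed.

Lemma hl2_le0 (f : hl2) x : x <= 0 -> f x = 0.
Proof. by case: f => f /= /hl2_predP[_]; apply. Qed.

Lemma hl2P (f : R -> R) : sqint mu f -> (forall x, x <= 0 -> f x = 0) ->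
  f \in hl2_pred.
Proof. by move=> sf f0; apply/hl2_predP. Qed.

Lemma hl2DE (f g : hl2) x : (f + g) x = f x + g x. Proof. by []. Qed.
Lemma hl2BE (f g : hl2) x : (f - g) x = f x - g x. Proof. by []. Qed.
Lemma hl2ZE a (f : hl2) x : (a *: f) x = a * f x. Proof. by []. Qed.

Lemma hl2_sumE (I : Type) (r : seq I) (F : I -> hl2) x :
  (\sum_(i <- r) F i) x = \sum_(i <- r) F i x.
Proof. by elim/big_rec2 : _ => // i y f _ <-. Qed.

Definition hl2_dot (f g : hl2) : R := \int[mu]_x (f x * g x).

Lemma hl2_dot_psd : psd_form hl2_dot.
Proof.
split.
- by move=> f g; apply: eq_Rintegral => x _; rewrite mulrC.
- move=> a f g h.
  rewrite /hl2_dot -RintegralZl//; last exact: sqint_mul (hl2_sqint _) (hl2_sqint _).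
  rewrite -RintegralD//.
  + by apply: eq_Rintegral => x _; rewrite hl2DE hl2ZE mulrDl mulrA.
  + apply: integrable_EFinZl; exact: sqint_mul (hl2_sqint _) (hl2_sqint _).
  + exact: sqint_mul (hl2_sqint _) (hl2_sqint _).
- by move=> f; apply: Rintegral_ge0 => x _; rewrite -expr2 sqr_ge0.
Qed.

Lemma hl2_dotE (f : hl2) : hl2_dot f f = \int[mu]_x (f x) ^+ 2.
Proof. by apply: eq_Rintegral => x _; rewrite expr2. Qed.

Lemma hl2_dot_eq0 (f : hl2) : hl2_dot f f = 0 -> ae_eq mu setT f (fun=> 0).
Proof. by rewrite hl2_dotE; apply: Rintegral_sqr_eq0; exact: hl2_sqint. Qed.

Lemma hl2_complete : form_complete hl2_dot.
Proof.
move=> x cx; have [|g sg gP] := sqint_complete (fun n => hl2_sqint (x n)).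
  move=> eps /cx[N NP]; exists N => k l Nk Nl.
  by have := NP _ _ Nk Nl; rewrite hl2_dotE.
pose g0 := g \_ `]0, +oo[.
have mg0 : measurable_fun setT g0.
  apply/(measurable_restrictT _ _).1 => //.
  by case: sg => + _; exact: measurable_funS.
have sg0 : sqint mu g0.
  apply: le_sqint sg => // y; rewrite /g0 patchE.
  by case: ifPn => //; rewrite normr0.
have g0P : g0 \in hl2_pred.
  apply: hl2P => // y y0; rewrite /g0 patchE memNset//= in_itv/= andbT.
  by apply/negP; rewrite -leNgt.
exists (Hl2 g0P); apply/cvgrPdist_le => eps eps0.
have [N NP] := gP _ eps0; exists N => // k /= Nk.
have [sk kg] := NP _ Nk.
rewrite sub0r normrN ger0_norm ?(form_ge0 hl2_dot_psd)// hl2_dotE.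
apply: le_trans kg; apply: le_Rintegral => //.
- by case: (hl2_sqint (x k - Hl2 g0P)).
- by case: sk.
- move=> y _; rewrite hl2BE /= /g0 patchE; case: ifPn => // yn.
  rewrite hl2_le0 ?subrr ?expr0n ?sqr_ge0//.
  by move: yn; rewrite notin_setE/= in_itv/= andbT => /negP; rewrite -leNgt.
Qed.

(** * Infinite dimension *)

Definition unit_indic (n : nat) : R -> R := \1_(`]n%:R, n.+1%:R]).

Lemma integral_unit_indic n : (\int[mu]_x (unit_indic n x)%:E = 1)%E.
Proof.
rewrite /unit_indic integral_indic// setIT.
apply: etrans (lebesgue_measure_itv _) _.
by rewrite /= lte_fin ltr_nat ltnSn -EFinB -natrB// subSnn.
Qed.

Lemma unit_indic_hl2 n : unit_indic n \in hl2_pred.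
Proof.
apply: hl2P.
- apply: sqintP; first by rewrite /unit_indic.
  rewrite (_ : (\int[mu]_x _)%E = \int[mu]_x (unit_indic n x)%:E)%E; last first.
    apply: eq_integral => x _; rewrite /unit_indic indicE.
    by case: (_ \in _); rewrite ?expr1n ?expr0n.
  by rewrite integral_unit_indic ltry.
- move=> x x0; rewrite /unit_indic indicE memNset//= in_itv/=.
  by move=> /andP[+ _]; rewrite ltNge (le_trans x0).
Qed.

Lemma unit_indic_orthonormal :
  orthonormal hl2_dot (fun n => Hl2 (unit_indic_hl2 n)).
Proof.
move=> i j; rewrite /hl2_dot /= /unit_indic.
have [<-|ij] := eqVneq i j.
  rewrite /Rintegral.
  rewrite (_ : (\int[mu]_x _)%E = \int[mu]_x (unit_indic i x)%:E)%E; last first.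
    apply: eq_integral => x _; rewrite /unit_indic indicE.
    by case: (_ \in _); rewrite ?mulr1 ?mulr0.
  by rewrite integral_unit_indic.
rewrite (_ : (fun x => _) = fun=> 0); first by rewrite Rintegral_cst// mul0r.
apply/funext => x; rewrite !indicE.
have [xi|] := boolP (x \in _); last by rewrite mul0r.
have [xj|] := boolP (x \in _); last by rewrite mulr0.
move: xi xj; rewrite !inE/= !in_itv/= => /andP[i1 i2] /andP[j1 j2].
have := lt_le_trans i1 j2; have := lt_le_trans j1 i2; rewrite !ltr_nat !ltnS.
by move=> ji ij'; case/eqP: ij; apply/eqP; rewrite eqn_leq ij' ji.
Qed.

Lemma hl2_infinite_dim : infinite_dim hl2_dot.
Proof.
move=> n v; pose e i := Hl2 (unit_indic_hl2 i).
have eO : orthonormal_upto hl2_dot n.+1 e.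
  by move=> i j _ _; exact: unit_indic_orthonormal.
have [c [i ni ci] cP] :=
  homogeneous_system_solution n (fun i j => hl2_dot (v j) (e i)).
exists (\sum_(i < n.+1) c i *: e i).
  rewrite (dot_sum_sqr hl2_dot_psd c eO)// psumr_neq0; last first.
    by move=> *; exact: sqr_ge0.
  apply/hasP; exists (Ordinal ni); first exact: mem_index_enum.
  by rewrite /= lt_neqAle eq_sym sqrf_eq0 ci sqr_ge0.
move=> j jn; rewrite (form_sumr hl2_dot_psd) -[RHS](cP _ jn).
by apply: eq_bigr => k _; rewrite (formZr hl2_dot_psd).
Qed.

End HalfLineL2.

(** * Kernels with exponential decay *)

Section ExpKernel.
Context {R : realType}.
Notation mu := (@lebesgue_measure R).
Implicit Types (L C s x : R).

Let expfun_is_derive L s x :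
  is_derive x 1 (fun x => - L^-1 * expR (- (L * (x - s)))) 
    (- L^-1 * (expR (- (L * (x - s))) * - L)).
Proof.
pose g (y : R) := - (L * (y - s)).
have dg : is_derive x 1 g (- L).
  have -> : g = (- L) *: ((fun y => y) - cst s).
    by apply/funext => y; rewrite /g -mulNr.
  by apply: is_derive_eq; rewrite subr0 [LHS]mulr1.
have de := is_derive1_comp (is_derive_expR (g x)) dg.
have -> : (fun x => - L^-1 * expR (- (L * (x - s)))) = (- L^-1) *: (expR \o g).
  by apply/funext => y; rewrite !fctE.
exact: is_derive_eq.
Qed.

Lemma integral_exp_right L s : 0 < L ->
  (\int[mu]_(x in `[s, +oo[) (expR (- (L * (x - s))))%:E = (L^-1)%:E)%E.
Proof.
move=> L0; pose F (x : R) := - L^-1 * expR (- (L * (x - s))).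
have cE : continuous (fun x : R => expR (- (L * (x - s)))).
  move=> x; apply: continuous_comp; last exact: continuous_expR.
  apply: cvgN; apply: cvgM; first exact: cvg_cst.
  by apply: cvgB; [exact: cvg_id|exact: cvg_cst].
have cF : continuous F.
  by move=> x; apply: cvgM; [exact: cvg_cst|exact: cE].
rewrite (@ge0_continuous_FTC2y _ _ F s 0).
- by rewrite /F subrr mulr0 oppr0 expR0 mulr1 EFinN oppeK add0e.
- by move=> x _; exact: expR_ge0.
- exact: continuous_subspaceT.
- rewrite -[X in _ --> X](mulr0 (- L^-1)); apply: cvgM; first exact: cvg_cst.
  rewrite (_ : (fun x => expR _) =
    (fun z => expR (- z)) \o (fun z => L * (z - s))) //.
  apply: (@cvg_comp _ _ _ _ _ _ (pinfty_nbhs R)); last exact: cvgr_expR.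
  apply/cvgryPge => M; exists (M / L + s); split; first exact: num_real.
  by move=> z /ltW; rewrite -lerBrDr ler_pdivrMr// mulrC.
- by move=> x _; have := expfun_is_derive L s x => -[].
- by apply: cvg_at_right_filter; exact: cF.
- move=> x _; rewrite derive1E; have := expfun_is_derive L s x => -[_ ->].
  by rewrite mulrCA mulrNN mulVf ?mulr1// gt_eqF.
Qed.

Lemma integral_exp_left L x : 0 < L ->
  (\int[mu]_(s in `]-oo, x]) (expR (- (L * (x - s))))%:E = (L^-1)%:E)%E.
Proof.
move=> L0; rewrite -(integral_exp_right (- x) L0).
have := @ge0_integration_by_substitutionNy R (fun s => expR (- (L * (x - s)))) (- x).
rewrite opprK => ->.
- by apply: eq_integral => t _ /=; rewrite !opprK addrC.
- apply: continuous_subspaceT => s; apply: continuous_comp; last exact: continuous_expR.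
  apply: cvgN; apply: cvgM; first exact: cvg_cst.
  by apply: cvgB; [exact: cvg_cst|exact: cvg_id].
- by move=> s _; exact: expR_ge0.
Qed.

(** The point is the factor [1 / L]: a kernel that decays fast has a small norm. *)
Lemma exp_schur_kernel (k : R -> R -> R) L C : 0 < L -> 0 <= C ->
  measurable_fun setT (fun z : R * R => k z.1 z.2) ->
  (forall s x, 0 <= k s x) ->
  (forall s x, k s x <= if s <= x then C * expR (- (L * (x - s))) else 0) ->
  schur_kernel k (C / L) (C / L) C.
Proof.
move=> L0 C0 mk k0 kle.
have mE (D : set R) (g : R -> R) : measurable D -> measurable_fun setT g ->
    measurable_fun setT ((fun x => (C * expR (- (L * g x)))%:E) \_ D).
  move=> mD mg; apply/(measurable_restrictT _ _).1 => //.
  apply: measurable_funTS; apply/measurable_EFinP; apply: measurable_funM => //.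
  apply: measurableT_comp => //; apply: measurableT_comp => //.
  exact: measurable_funM.
have CI (D : set R) (g : R -> R) (u : R -> R) : measurable D ->
    measurable_fun setT g -> measurable_fun setT u -> (forall x, 0 <= u x) ->
    (forall x, u x <= if x \in D then C * expR (- (L * g x)) else 0) ->
    (\int[mu]_(x in D) (expR (- (L * g x)))%:E = (L^-1)%:E)%E ->
    (\int[mu]_x (u x)%:E <= (C / L)%:E)%E.
  move=> mD mg mu_ u0 ule gL.
  apply: (@le_trans _ _ (\int[mu]_x (((fun x => (C * expR (- (L * g x)))%:E) \_ D) x))%E).
    apply: ge0_le_integral => //.
    - by move=> x _; rewrite lee_fin.
    - exact/measurable_EFinP.
    - exact: mE.
    - by move=> x _; rewrite patchE; have := ule x; case: ifP.
  rewrite -integral_mkcond; under eq_integral do rewrite EFinM.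
  rewrite ge0_integralZl//; first by rewrite gL -EFinM.
  apply: measurable_funTS; apply/measurable_EFinP.
  apply: measurableT_comp => //; apply: measurableT_comp => //.
  exact: measurable_funM.
have msub s : measurable_fun setT (fun x : R => x - s) by exact: measurable_funB.
have msub' x : measurable_fun setT (fun s : R => x - s) by exact: measurable_funB.
split => //.
- move=> s x; apply: le_trans (kle s x) _; case: ifP => // sx.
  by rewrite -[leRHS]mulr1 ler_wpM2l// expR_le1 oppr_le0 mulr_ge0 ?subr_ge0// ltW.
- move=> s; apply: (CI `[s, +oo[%classic (fun x => x - s) (k s)) => //.
  + exact: (measurableT_comp mk (pair1_measurable s)).
  + move=> x; apply: le_trans (kle s x) _.
    by rewrite mem_setE in_itv/= andbT.
  + exact: integral_exp_right.
- move=> x; apply: (CI `]-oo, x]%classic (fun s => x - s) (k ^~ x)) => //.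
  + exact: (measurableT_comp mk (pair2_measurable x)).
  + move=> s; apply: le_trans (kle s x) _.
    by rewrite mem_setE in_itv/=.
  + exact: integral_exp_left.
Qed.

End ExpKernel.

(** * The factor of the Green kernel *)

Section GreenKernel.
Context {R : realType}.
Notation mu := (@lebesgue_measure R).

Lemma measurable_half_line : measurable (@half_line R).
Proof. exact: measurable_itv. Qed.

(** All that the study of [K] needs to know. [dec_fast], with one [kappa] for all rates, is the
    trace of [sigma' --> +oo]. Both [phi] and [exp (- sigma)] will be instances. *)
Record decaying (phi : R -> R) (kappa c : R) : Prop := Decaying {
  dec_sqint : square_integrable half_line phi;
  dec_gt0 : forall x, 0 < x -> 0 < phi x;
  dec_kappa : 0 < kappa;
  dec_c : 0 < c;
  dec_le : forall s x, 0 < s -> s <= x ->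
    phi x <= kappa * expR (- (c * (x - s))) * phi s;
  dec_fast : forall L, 0 < L -> exists N, forall s x, N <= s -> 0 < s -> s <= x ->
    phi x <= kappa * expR (- (L * (x - s))) * phi s }.

Context (phi : R -> R) (kappa c : R) (D : decaying phi kappa c).

(* [phi0] vanishes on [x <= 0], and so does its inverse, as [0^-1 = 0]; hence
   [gker] below is supported on [0 < s <= x]. *)
Definition phi0 : R -> R := phi \_ half_line.

Lemma phi0_pos x : 0 < x -> phi0 x = phi x.
Proof. by move=> x0; rewrite /phi0 patchE mem_set// /half_line /= in_itv/= x0. Qed.

Lemma phi0_le0 x : x <= 0 -> phi0 x = 0.
Proof.
move=> x0; rewrite /phi0 patchE memNset// /half_line /= in_itv/= andbT.
by apply/negP; rewrite -leNgt.
Qed.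

Lemma phi0_ge0 x : 0 <= phi0 x.
Proof.
have [x0|x0] := ltP 0 x; last by rewrite phi0_le0.
by rewrite phi0_pos// ltW// (dec_gt0 D).
Qed.

Lemma phi0_measurable : measurable_fun setT phi0.
Proof.
exact: (measurable_restrictT phi measurable_half_line).1 (dec_sqint D).1.
Qed.

Lemma phi0_sqint : sqint mu phi0.
Proof.
split; first exact: phi0_measurable.
have mH : measurable (@half_line R : set (g_sigma_algebraType R.-ocitv.-measurable)).
  exact: measurable_itv.
have := (integrable_mkcond _ mH).1 (dec_sqint D).2.
apply: eq_integrable => // x _ /=.
by rewrite /phi0 !patchE; case: ifP; rewrite //= expr0n.
Qed.

Lemma phi0V_measurable : measurable_fun setT (fun x => (phi0 x)^-1).
Proof.
rewrite (_ : (fun x => _) =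
    fun x => if 0 < phi0 x then expR (- ln (phi0 x)) else 0); last first.
  apply/funext => x; case: ltP => [x0|x0]; first by rewrite expRN lnK.
  suff -> : phi0 x = 0 by rewrite invr0.
  by apply/eqP; rewrite eq_le x0 phi0_ge0.
have mphi := phi0_measurable.
apply: measurable_fun_ifT => //.
  exact: measurable_fun_ltr.
apply: measurableT_comp => //; apply: measurableT_comp => //.
exact: measurableT_comp.
Qed.

Definition gker (s x : R) : R := if s <= x then phi0 x * (phi0 s)^-1 else 0.

Lemma gker_le0l s x : s <= 0 -> gker s x = 0.
Proof. by move=> s0; rewrite /gker (phi0_le0 s0) invr0 mulr0 if_same. Qed.

Lemma gker_le0r s x : x <= 0 -> gker s x = 0.
Proof. by move=> x0; rewrite /gker (phi0_le0 x0) mul0r if_same. Qed.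

Lemma gker_ge0 s x : 0 <= gker s x.
Proof. by rewrite /gker; case: ifP => // _; rewrite mulr_ge0 ?invr_ge0 ?phi0_ge0. Qed.

Lemma gker_measurable : measurable_fun setT (fun z : R * R => gker z.1 z.2).
Proof.
apply: measurable_fun_ifT => //; first exact: measurable_fun_ler.
apply: measurable_funM.
  exact: (measurableT_comp phi0_measurable measurable_snd).
exact: (measurableT_comp phi0V_measurable measurable_fst).
Qed.

Let gker_le_exp L s x : (0 < s -> s <= x ->
    phi x <= kappa * expR (- (L * (x - s))) * phi s) ->
  gker s x <= if s <= x then kappa * expR (- (L * (x - s))) else 0.
Proof.
have [s0|s0] := ltP 0 s; last first.
  move=> _; rewrite gker_le0l//; case: ifP => // _.
  by rewrite mulr_ge0 ?expR_ge0// ltW// (dec_kappa D).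
move=> /(_ isT); rewrite /gker; case: ifP => // sx /(_ isT).
rewrite !phi0_pos//; last exact: lt_le_trans sx.
by rewrite ler_pdivrMr// (dec_gt0 D).
Qed.

Lemma gker_schur : schur_kernel gker (kappa / c) (kappa / c) kappa.
Proof.
apply: exp_schur_kernel (dec_c D) (ltW (dec_kappa D)) gker_measurable gker_ge0 _.
by move=> s x; apply: gker_le_exp => s0 sx; exact: (dec_le D).
Qed.

(** * Approximation of the kernel by finite rank *)

Section Cut.
Variables (L : R) (L0 : 0 < L).
Let d := L^-1.
Let d0 : 0 < d. Proof. by rewrite invr_gt0. Qed.

(* [cut_ker] is [gker] minus a kernel of finite rank: for [s] in the cell
   [j / L <= s < (j + 1) / L] of [(0, m / L)] only the values of [x] in the same
   cell remain, so that [L * (x - s) <= 1] there. The cut kernel thus decays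
   like [exp (- L * (x - s))] everywhere. *)
Definition cut_left (j : nat) (s : R) : R :=
  if (j%:R * d <= s) && (s < j.+1%:R * d) then (phi0 s)^-1 else 0.

Definition cut_right (j : nat) (x : R) : R :=
  if j.+1%:R * d < x then phi0 x else 0.

Definition cut_ker (m : nat) (s x : R) : R :=
  gker s x - \sum_(j < m) cut_left j s * cut_right j x.

Lemma cut_left_hl2 j : cut_left j \in hl2_pred.
Proof.
apply: hl2P; last first.
  by move=> x x0; rewrite /cut_left phi0_le0// invr0 if_same.
pose q := j.+1%:R * d; have q0 : 0 < q by rewrite mulr_gt0.
have ml : measurable_fun setT (cut_left j).
  apply: measurable_fun_ifT => //; last exact: phi0V_measurable.
  by apply: measurable_and; [exact: measurable_fun_ler|exact: measurable_fun_ltr].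
pose E : set R := `]0, q]%classic.
have mE : measurable E by exact: measurable_itv.
(* [dec_le] up to the right end [q] of the cell gives [phi q <= kappa * phi s], so [1 / phi s] is at
   most [kappa / phi q] all the way down to [0]. *)
pose g := (kappa / phi q) \o* (\1_E : R -> R).
have sg : sqint mu g.
  apply: sqintP; first by apply: measurable_funM => //; exact: measurable_indic.
  rewrite (_ : (\int[mu]_x _)%E =
      \int[mu]_(x in E) (((kappa / phi q) ^+ 2)%:E))%E; last first.
    rewrite [RHS]integral_mkcond; apply: eq_integral => x _.
    rewrite /g /= patchE indicE; case: (_ \in _).
      by rewrite mul1r.
    by rewrite mul0r expr0n.
  rewrite integral_cst; last exact: measurable_itv.
  rewrite [X in (_ * X)%E](_ : _ = q%:E) -?EFinM ?ltry//.
  apply: etrans (lebesgue_measure_itv _) _.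
  by rewrite /= lte_fin q0 -EFinB subr0.
apply: le_sqint sg => // s; rewrite /g /cut_left /=.
case: ifP => [/andP[s1 s2]|_]; last by rewrite normr0.
have [s0|s0] := ltP 0 s; last by rewrite phi0_le0// invr0 normr0.
rewrite indicE mem_set ?mul1r; last by rewrite /E /= in_itv/= s0 ltW.
have ps := dec_gt0 D s0; have pq := dec_gt0 D q0.
rewrite phi0_pos// ger0_norm ?invr_ge0 ?(ltW ps)//.
apply: le_trans (ler_norm _).
rewrite ler_pdivlMr// mulrC ler_pdivrMr//.
apply: le_trans (dec_le D s0 (ltW s2)) _.
rewrite ler_wpM2r ?(ltW ps)// -[leRHS]mulr1 ler_wpM2l ?(ltW (dec_kappa D))//.
by rewrite expR_le1 oppr_le0 mulr_ge0 ?subr_ge0 ?(ltW s2)// ltW// (dec_c D).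
Qed.

Lemma cut_right_hl2 j : cut_right j \in hl2_pred.
Proof.
apply: hl2P; last first.
  by move=> x x0; rewrite /cut_right phi0_le0// if_same.
apply: le_sqint phi0_sqint.
  by apply: measurable_fun_ifT => //; [exact: measurable_fun_ltr|exact: phi0_measurable].
by move=> x; rewrite /cut_right; case: ifP => // _; rewrite normr0.
Qed.

(** The [m] cells reach beyond the [N] of [dec_fast], and after them [gker] has the rate [L] by
    itself. Inside a cell [1 <= expR 1 * expR (- (L * (x - s)))], whence the factor [expR 1]. *)
Lemma cut_ker_schur : exists m,
  schur_kernel (cut_ker m) (kappa * expR 1 / L) (kappa * expR 1 / L) (kappa * expR 1).
Proof.
have [N NP] := dec_fast D L0.
pose m := (Num.truncn (N / d)).+1.
have Nm : N <= m%:R * d.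
  by rewrite -ler_pdivrMr// ltW// truncnS_gt.
exists m.
have kE0 : 0 <= kappa * expR 1 by rewrite mulr_ge0 ?expR_ge0// ltW// (dec_kappa D).
have cutE s x : 0 < s -> cut_ker m s x =
    if (s < m%:R * d) && ((Num.truncn (s / d)).+1%:R * d < x) then 0 else gker s x.
  move=> s0; rewrite /cut_ker; set j := Num.truncn (s / d).
  have sd0 : 0 <= s / d by rewrite divr_ge0 ?ltW.
  have /andP[j1 j2] := truncn_itv sd0.
  have cell i : (i%:R * d <= s) && (s < i.+1%:R * d) = (i == j).
    by rewrite -ler_pdivlMr// -ltr_pdivrMr// -truncn_eq// eq_sym.
  have E i : cut_left i s * cut_right i x =
      if i == j then (phi0 s)^-1 * (if j.+1%:R * d < x then phi0 x else 0) else 0.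
    rewrite /cut_left cell /cut_right; case: eqP => [->//|_]; by rewrite mul0r.
  under eq_bigr do rewrite E.
  have [sm|sm] := ltP s (m%:R * d) => /=.
    have jm : (j < m)%N.
      by rewrite -(ltr_nat R) (le_lt_trans j1)// ltr_pdivrMr.
    rewrite (bigD1 (Ordinal jm))//= eqxx big1 ?addr0; last first.
      by move=> i; rewrite -val_eqE/= => /negbTE ->.
    case: ifP => jx; last by rewrite mulr0 subr0.
    have sx : s <= x by rewrite ltW// (lt_trans _ jx)// -ltr_pdivrMr.
    by rewrite /gker sx [X in X - _]mulrC subrr.
  rewrite big1 ?subr0// => i _; case: eqP => // ij.
  have jm : (j < m)%N by rewrite -ij.
  have : s / d < m%:R by apply: lt_le_trans j2 _; rewrite ler_nat.
  by rewrite ltr_pdivrMr// ltNge sm.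
apply: exp_schur_kernel => //.
- apply: measurable_funB; first exact: gker_measurable.
  apply: measurable_sum => i; apply: measurable_funM.
    have [ml _] := hl2_sqint (Hl2 (cut_left_hl2 i)).
    exact: (measurableT_comp ml measurable_fst).
  have [mr _] := hl2_sqint (Hl2 (cut_right_hl2 i)).
  exact: (measurableT_comp mr measurable_snd).
- move=> s x; have [s0|s0] := ltP 0 s; last first.
    rewrite /cut_ker gker_le0l// big1 ?subr0// => i _.
    by rewrite /cut_left phi0_le0// invr0 if_same mul0r.
  by rewrite cutE//; case: ifP => // _; exact: gker_ge0.
- move=> s x; have [s0|s0] := ltP 0 s; last first.
    rewrite /cut_ker gker_le0l// big1 ?subr0 => [|i _].
      by case: ifP => // _; rewrite mulr_ge0 ?expR_ge0.
    by rewrite /cut_left phi0_le0// invr0 if_same mul0r.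
  rewrite cutE//; have [sx|xs] := leP s x; last first.
    by rewrite /gker (lt_geF xs) if_same.
  have [sm|sm] := ltP s (m%:R * d) => /=; last first.
    apply: le_trans (gker_le_exp (L := L) _) _.
      by move=> _ _; apply: NP => //; exact: le_trans sm.
    rewrite sx ler_wpM2r ?expR_ge0// ler_peMr ?(ltW (dec_kappa D))//.
    by rewrite -[leLHS]expR0 ler_expR.
  case: ifPn => [_|]; first by rewrite mulr_ge0 ?expR_ge0.
  rewrite -leNgt => xj.
  apply: (@le_trans _ _ kappa).
    apply: le_trans (schur_le gker_schur s x) _; exact: lexx.
  rewrite -mulrA -expRD ler_peMr ?(ltW (dec_kappa D))// -[leLHS]expR0 ler_expR.
  have sd0 : 0 <= s / d by rewrite divr_ge0 ?ltW.
  have /andP[j1 j2] := truncn_itv sd0.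
  rewrite -[X in X * d]natr1 mulrDl mul1r in xj.
  rewrite ler_pdivlMr// in j1.
  have xsd : x - s <= d by lra.
  rewrite subr_ge0 (le_trans (ler_wpM2l (ltW L0) xsd))//.
  by rewrite /d mulfV ?gt_eqF.
Qed.

End Cut.
End GreenKernel.

(** * The quadratic form of the Green operator *)

Section GreenForm.
Context {R : realType}.
Notation mu := (@lebesgue_measure R).
Context (phi : R -> R) (kappa c : R) (D : decaying phi kappa c).
Local Notation V := (@hl2 R).
Local Notation k := (gker phi).
Local Notation kT := (fun x s => gker phi s x).

Let kc0 : 0 < kappa / c.
Proof. by rewrite divr_gt0 ?(dec_kappa D) ?(dec_c D). Qed.

Let kS := gker_schur D.
Let kTS := schur_kernelC kS.

Lemma greenK_hl2 (f : V) : kernel_op k f \in hl2_pred.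
Proof.
apply: hl2P; first exact: (schur_test kS kc0 (hl2_sqint f)).1.
move=> s s0; rewrite /kernel_op (_ : (fun x => _) = fun=> 0).
  by rewrite Rintegral_cst// mul0r.
by apply/funext => x; rewrite gker_le0l// mul0r.
Qed.

Definition greenK (f : V) : V := Hl2 (greenK_hl2 f).

Lemma greenKt_hl2 (f : V) : kernel_op kT f \in hl2_pred.
Proof.
apply: hl2P; first exact: (schur_test kTS kc0 (hl2_sqint f)).1.
move=> s s0; rewrite /kernel_op (_ : (fun x => _) = fun=> 0).
  by rewrite Rintegral_cst// mul0r.
by apply/funext => x; rewrite gker_le0r// mul0r.
Qed.

Definition greenKt (f : V) : V := Hl2 (greenKt_hl2 f).

Lemma greenK_adjoint (f g : V) : hl2_dot (greenK f) g = hl2_dot f (greenKt g).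
Proof. exact: (kernel_op_adjoint kS kc0 (hl2_sqint f) (hl2_sqint g)). Qed.

Lemma greenK_lin a (f g : V) : greenK (a *: f + g) = a *: greenK f + greenK g.
Proof.
apply/val_inj/funext => s.
have If := schur_integrable kS s (hl2_sqint f).
have Ig := schur_integrable kS s (hl2_sqint g).
transitivity (a * kernel_op k f s + kernel_op k g s); last by [].
rewrite /kernel_op -RintegralZl// -RintegralD//; last exact: integrable_EFinZl.
apply: eq_Rintegral => x _.
by rewrite [X in _ * X](_ : _ = a * f x + g x)// mulrDr mulrCA.
Qed.

Definition green_form (f g : V) : R := hl2_dot (greenK f) (greenK g).

Lemma green_form_psd : psd_form green_form.
Proof.
split.
- by move=> u v; exact: (form_sym hl2_dot_psd).
- by move=> a u v w; rewrite /green_form greenK_lin (form_lin hl2_dot_psd).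
- by move=> u; exact: (form_ge0 hl2_dot_psd).
Qed.

Lemma green_form_le (f : V) :
  green_form f f <= kappa / c * (kappa / c) * hl2_dot f f.
Proof.
rewrite /green_form !hl2_dotE.
exact: (schur_test kS kc0 (hl2_sqint f)).2.
Qed.

Lemma green_form_compact : form_compact hl2_dot green_form.
Proof.
move=> eps eps0.
have ke0 : 0 < kappa * expR 1 by rewrite mulr_gt0 ?expR_gt0 ?(dec_kappa D).
have e1 : 0 < 1 + 2 / eps by rewrite addr_gt0// divr_gt0.
(* The Schur bound of the cut kernel becomes [1 / (1 + 2 / eps)]. This is at most [1] and at most
   [eps / 2], hence so is its square. *)
pose L := kappa * expR 1 * (1 + 2 / eps).
have L0 : 0 < L by rewrite mulr_gt0.
have [m mS] := cut_ker_schur D L0.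
pose w j : V := Hl2 (cut_left_hl2 D L0 j).
pose v j : V := Hl2 (cut_right_hl2 D L j).
have keL : kappa * expR 1 / L = (1 + 2 / eps)^-1.
  by rewrite /L invfM mulrA mulfV ?gt_eqF// mul1r.
have keL0 : 0 < kappa * expR 1 / L by rewrite divr_gt0.
(* The constants of [formD_le] and [form_sum_le] and the norm of [w j]; their square root is put
   into the functional. *)
pose M j := 2 * (2 ^+ m * hl2_dot (w j) (w j)).
have M0 j : 0 <= M j.
  by rewrite !mulr_ge0 ?exprn_ge0//; exact: (form_ge0 hl2_dot_psd).
exists m, (fun j => Num.sqrt (M j) *: v j) => f.
have [sC leC] := schur_test mS keL0 (hl2_sqint f).
pose S := \sum_(j < m) hl2_dot (v j) f *: w j.
have KE : greenK f - S = kernel_op (cut_ker phi L m) f :> (R -> R).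
  apply/funext => s; rewrite hl2BE /S hl2_sumE /=.
  have If := schur_integrable kS s (hl2_sqint f).
  have Iv j : mu.-integrable setT (EFin \o (fun x => cut_right phi L j x * f x)).
    exact: (sqint_mul (hl2_sqint (v j)) (hl2_sqint f)).
  rewrite /kernel_op /cut_ker.
  transitivity (\int[mu]_x (k s x * f x -
      \sum_(j < m) (cut_left phi L j s * (cut_right phi L j x * f x)))); last first.
    apply: eq_Rintegral => x _; rewrite mulrBl mulr_suml.
    by congr (_ - _); apply: eq_bigr => j _; rewrite mulrA.
  have Iw j : mu.-integrable setT
      (EFin \o (fun x => cut_left phi L j s * (cut_right phi L j x * f x))).
    exact: integrable_EFinZl.
  have [Is IsE] := Rintegral_sum m Iw.
  rewrite RintegralB// IsE; congr (_ - _); apply: eq_bigr => j _.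
  by rewrite RintegralZl// mulrC.
have SS : hl2_dot S S <= 2 ^+ m * \sum_(j < m) hl2_dot (w j) (w j) * hl2_dot (v j) f ^+ 2.
  apply: le_trans (form_sum_le hl2_dot_psd m (fun j => hl2_dot (v j) f *: w j)) _.
  rewrite ler_wpM2l ?exprn_ge0//; apply: ler_sum => j _.
  by rewrite (formZl hl2_dot_psd) (formZr hl2_dot_psd) mulrA -expr2 mulrC.
have KS : hl2_dot (greenK f - S) (greenK f - S) <= eps / 2 * hl2_dot f f.
  rewrite !hl2_dotE KE (le_trans leC)// ler_wpM2r//.
    by apply: Rintegral_ge0 => x _; exact: sqr_ge0.
  rewrite keL; have i1 : (1 + 2 / eps)^-1 <= 1 by rewrite invf_le1// lerDl divr_ge0// ltW.
  have i2 : (1 + 2 / eps)^-1 <= eps / 2.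
    by rewrite -[leRHS]invrK lef_pV2 ?posrE ?invr_gt0 ?divr_gt0// invf_div lerDr.
  by rewrite -[leRHS]mul1r ler_pM// invr_ge0 ltW.
have KD : green_form f f <= 2 * (hl2_dot (greenK f - S) (greenK f - S) + hl2_dot S S).
  by have := formD_le hl2_dot_psd (greenK f - S) S; rewrite subrK.
apply: le_trans KD _.
have -> : \sum_(j < m) hl2_dot (Num.sqrt (M j) *: v j) f ^+ 2 =
    2 * (2 ^+ m * \sum_(j < m) hl2_dot (w j) (w j) * hl2_dot (v j) f ^+ 2).
  rewrite !mulr_sumr; apply: eq_bigr => j _.
  by rewrite (formZl hl2_dot_psd) exprMn sqr_sqrtr// /M !mulrA.
lra.
Qed.

Lemma greenK_tail (f : V) s : 0 < s -> greenK f s =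
  (phi0 phi s)^-1 * \int[mu]_(x in `]s, +oo[) (phi0 phi x * f x).
Proof.
move=> s0; have Ih := sqint_mul (phi0_sqint D) (hl2_sqint f).
rewrite Rintegral_itv_obnd_cbnd; last exact: integrableS Ih.
rewrite -RintegralZl//; last exact: integrableS Ih.
rewrite [RHS]Rintegral_mkcond; apply: eq_Rintegral => x _.
rewrite patchE mem_setE in_itv/= andbT /gker.
by case: ifP; rewrite ?mul0r// mulrAC mulrC.
Qed.

(** If [K f] vanishes almost everywhere, so do the tail integrals of [h], and its primitive [F]
    equals a constant off a null set. At a point outside this set where [F] has derivative
    [h x != 0], [F] differs from [F x] on a whole interval, which a null set cannot contain. *)
Lemma green_form_eq0 (f : V) : green_form f f = 0 -> hl2_dot f f = 0.
Proof.
move=> /hl2_dot_eq0 K0; pose h x := phi0 phi x * f x.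
have Ih : mu.-integrable setT (EFin \o h).
  exact: sqint_mul (phi0_sqint D) (hl2_sqint f).
pose F x := \int[mu]_(t in `]-oo, x]) h t.
have dF : {ae mu, forall x, derivable F x 1 /\ F^`()%classic x = h x}.
  apply: FTC1Ny; first by move=> y; exact: integrableS Ih.
  by apply: open_integrable_locally => //; exact: openT.
have FT s : 0 < s -> greenK f s = 0 -> F s = \int[mu]_x h x.
  move=> s0; rewrite greenK_tail// => /eqP.
  rewrite mulf_eq0 invr_eq0 phi0_pos// gt_eqF ?(dec_gt0 D)//= => /eqP tail0.
  have := @Rintegral_itvB R h -oo%O +oo%O s; rewrite set_itvNyy => /(_ Ih) /=.
  rewrite -/(F s) tail0 => /(_ _ _)/eqP; rewrite subr_eq0 => /(_ isT isT)/eqP.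
  by [].
suff f0 : ae_eq mu setT f (fun=> 0).
  have [mf _] := hl2_sqint f.
  rewrite hl2_dotE (ae_eq_Rintegral (g := fun=> 0)) ?Rintegral_cst ?mul0r//.
    exact: measurable_funX.
  have aeF := ae_filter_ringOfSetsType mu.
  by apply: filterS f0 => x fx0 Dx; rewrite fx0// expr0n.
case: K0 => N [mN N0 NP].
have NN : {ae mu, forall x, ~ N x} by exists N; split => // x /= /contrapT.
have aeF := ae_filter_ringOfSetsType mu.
apply: filterS2 dF NN => x [dx Fx] Nx _.
have [x0|x0] := ltP 0 x; last by rewrite hl2_le0.
suff : h x = 0.
  by move/eqP; rewrite mulf_eq0 phi0_pos// gt_eqF ?(dec_gt0 D)//= => /eqP.
apply/eqP; rewrite -[_ == _]negbK; apply/negP => hx0.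
have KN y : ~ N y -> greenK f y = 0.
  by move=> Ny; apply: contrapT => yK; apply: Ny; apply: NP => /= /(_ I).
have cD : t^-1 *: ((F \o shift x) (t *: (1:R)) - F x) @[t --> 0^'] --> h x.
  by rewrite -Fx derive1E; exact: dx.
have [e /= e0 eP] := cvgr_neq0 (h x) cD hx0.
pose I : set R := `]x, (x + e)[%classic.
have sub : I `<=` N.
  move=> y; rewrite /I /= in_itv/= => /andP[xy ye]; apply: contrapT => Ny.
  have /= := eP (y - x).
  rewrite sub0r normrN ger0_norm ?subr_ge0 ?(ltW xy)// ltrBlDl => /(_ ye).
  rewrite subr_eq0 gt_eqF// => /(_ isT); rewrite [_ *: 1]mulr1 subrK.
  by rewrite !FT ?subrr ?scaler0 ?eqxx//; [exact: KN| |exact: KN]; exact: lt_trans xy.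
have : (mu I <= mu N)%E.
  by apply: le_measure => //; rewrite inE; [exact: measurable_itv|exact: mN].
rewrite N0 leNgt => /negP; apply.
have -> : mu I = e%:E.
  apply: etrans (lebesgue_measure_itv _) _.
  by rewrite /= lte_fin ltrDl e0 -EFinB addrAC subrr add0r.
by rewrite lte_fin.
Qed.

(** * The Green function as the kernel of a product *)

Let integrable_phiV a : 0 < a ->
  mu.-integrable `]0, a] (EFin \o (fun s => (phi s ^+ 2)^-1)).
Proof.
move=> a0; have pa := dec_gt0 D a0.
(* The Schur bounds make the column [phi a / phi s] square-integrable in [s]; up to the constant
   [phi a ^+ 2], this is the claim. *)
have Ik : mu.-integrable setT (EFin \o (fun s => k s a * k s a)).
  exact: sqint_mul (schur_sqint_row kTS a) (schur_sqint_row kTS a).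
have Ika : mu.-integrable `]0, a] (EFin \o (fun s => k s a * k s a)).
  exact: integrableS Ik.
have mI : measurable (`]0, a]%classic : set (g_sigma_algebraType R.-ocitv.-measurable)).
  exact: measurable_itv.
have := integrableZl mI ((phi a ^+ 2)^-1) Ika.
apply: eq_integrable => // s.
rewrite inE/= in_itv/= => /andP[s0 sa]; rewrite -EFinM; congr EFin.
have ps := dec_gt0 D s0.
rewrite /gker sa !phi0_pos//; field.
by rewrite !gt_eqF.
Qed.

(** [psi] integrates from the closed endpoint [0], where [decaying] has no information on [phi]; a
    single point does not matter. *)
Lemma psiE x : 0 < x -> psi phi x = phi x * \int[mu]_(s in `]0, x]) (phi s ^+ 2)^-1.
Proof. by move=> x0; rewrite /psi Rintegral_itv_obnd_cbnd//; exact: integrable_phiV. Qed.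

Let gker_prod a b : 0 < a -> a <= b ->
  \int[mu]_s (k s a * k s b) =
  phi a * phi b * \int[mu]_(s in `]0, a]) (phi s ^+ 2)^-1.
Proof.
move=> a0 ab; rewrite -RintegralZl//; last exact: integrable_phiV.
rewrite [RHS]Rintegral_mkcond; apply: eq_Rintegral => s _.
rewrite patchE mem_setE in_itv/=.
have [s0|s0] := ltP 0 s; last by rewrite gker_le0l// mul0r.
rewrite /gker; have [sa|sa] := leP s a; last by rewrite mul0r.
rewrite (le_trans sa ab) !phi0_pos//; last exact: lt_le_trans ab.
by rewrite /=; field; rewrite gt_eqF// (dec_gt0 D).
Qed.

(** The kernel identity behind [G = K^* K]. The product lives on [0 < s <= min x y], where it is
    [phi x * phi y / phi s ^+ 2]; its integral is [psi] at the smaller point times [phi] at the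
    larger one. *)
Lemma greenE x y : 0 < x -> 0 < y -> green phi x y = \int[mu]_s (k s y * k s x).
Proof.
move=> x0 y0; rewrite /green; case: leP => [xy|/ltW yx].
  under eq_Rintegral do rewrite mulrC.
  by rewrite gker_prod// psiE// mulrAC.
by rewrite gker_prod// psiE// mulrCA mulrA.
Qed.

Lemma Gop_greenK (f : R -> R) (g : V) x : 0 < x -> {in half_line, f =1 g} ->
  \int[mu]_(y in half_line) (green phi x y * f y) = greenKt (greenK g) x.
Proof.
move=> x0 fg.
have sx := schur_sqint_row kTS x.
(* The exchange of integrals is the adjoint identity, tested against the column of the kernel at
   [x]. *)
have := kernel_op_adjoint kS kc0 (hl2_sqint g) sx.
rewrite [X in X = _ -> _](_ : _ = greenKt (greenK g) x); last first.
  by apply: eq_Rintegral => s _; rewrite mulrC.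
move=> ->; rewrite [LHS]Rintegral_mkcond; apply: eq_Rintegral => y _.
rewrite patchE /half_line mem_setE in_itv/= andbT.
have [y0|y0] := ltP 0 y; last by rewrite hl2_le0// mul0r.
rewrite fg; last by rewrite inE /half_line /= in_itv/= y0.
by rewrite greenE// mulrC.
Qed.

End GreenForm.

(** * Growth of sigma *)

Section Growth.
Context {R : realType}.
Notation mu := (@lebesgue_measure R).
Implicit Types (sigma dsigma d2sigma : R -> R).

Let half_line_nbhs (x : R) : 0 < x -> \forall y \near x, 0 <= y.
Proof. by move=> x0; exists x => //= y /ltr_normlW; lra. Qed.

Lemma C1_half_line_is_derive sigma dsigma (x : R) : C1_half_line sigma dsigma ->
  0 < x -> is_derive x 1 sigma (dsigma x).
Proof.
move=> [ds _] x0; have := ds x (ltW x0) => /cvgrPdist_lt dx.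
have cD : t^-1 *: ((sigma \o shift x) (t *: (1:R)) - sigma x) @[t --> 0^'] --> dsigma x.
  apply/cvgrPdist_lt => e /dx [/= d d0 dP].
  have [d' /= d'0 d'P] := half_line_nbhs x0.
  exists (Num.min d d') => /=; first by rewrite lt_min d0.
  move=> t /=; rewrite sub0r normrN lt_min => /andP[td td'] t0.
  have xt u : x - (u + x) = - u by rewrite opprD addrC addrNK.
  have := dP (t + x); rewrite /= xt normrN => /(_ td).
  have -> : (t + x != x) by rewrite -subr_eq0 addrK.
  have tx0 : 0 <= t + x by apply: d'P; rewrite /= xt normrN.
  rewrite in_itv/= tx0 => /(_ isT isT).
  by rewrite addrK [t *: 1]mulr1 [_ *: (_ - _)]mulrC.
apply: DeriveDef; first by apply/cvg_ex; exists (dsigma x).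
exact/cvg_lim.
Qed.

Lemma C1_half_line_continuous sigma dsigma (x : R) : C1_half_line sigma dsigma ->
  0 < x -> {for x, continuous dsigma}.
Proof.
move=> [_ cd] x0.
have [+ _] := (continuous_within_itvcyP 0 dsigma).1 cd.
by apply; rewrite in_itv/= x0.
Qed.

Lemma C1_half_line_growth sigma dsigma L N : C1_half_line sigma dsigma ->
  (forall x, N <= x -> 0 <= x -> L <= dsigma x) ->
  forall s x, N <= s -> 0 < s -> s <= x -> L * (x - s) <= sigma x - sigma s.
Proof.
move=> sC sL s x Ns s0; rewrite le_eqVlt => /predU1P[<-|sx].
  by rewrite !subrr mulr0.
have dS (y : R) : 0 < y -> is_derive y 1 sigma (dsigma y).
  by move=> y0; exact: C1_half_line_is_derive.
have [y||z] := @MVT R sigma dsigma s x sx.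
- by rewrite in_itv/= => /andP[sy _]; apply: dS; exact: lt_trans sy.
- apply: derivable_within_continuous => y; rewrite in_itv/= => /andP[sy _].
  by have := dS y (lt_le_trans s0 sy) => -[].
rewrite in_itv/= => /andP[sz zx] ->.
rewrite ler_wpM2r ?subr_ge0 ?(ltW sx)// sL// ltW//; first exact: le_lt_trans sz.
exact: lt_trans sz.
Qed.

Section Unbounded.
Variables (sigma dsigma d2sigma : R -> R) (c X : R).
Hypothesis sC : C1_half_line sigma dsigma.
Hypothesis c0 : 0 < c.
Hypothesis sc : forall x, 0 <= x -> c <= dsigma x.
Hypothesis X0 : 0 <= X.
Hypothesis dd : weak_derivative_from X dsigma d2sigma.
Hypothesis V_lim : dsigma x ^+ 2 - d2sigma x @[x --> +oo] --> +oo.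

(* Where [dsigma] is below [L], the equation [d2sigma = dsigma ^+ 2 - V] with
   [V >= 2 * L ^+ 2] makes it decrease at a definite rate, which contradicts
   its positivity. *)
Lemma dsigma_unbounded (L : R) : 0 < L -> exists N, forall x, N <= x -> L <= dsigma x.
Proof.
move=> L0; have /cvgryPge/(_ (2 * L ^+ 2))[M [_ MP]] := V_lim.
pose N := Num.max X M + 1; have XN : X < N by rewrite ltr_pwDr// le_max lexx.
have MN : M < N by rewrite ltr_pwDr// le_max lexx orbT.
exists N => x0 Nx0; rewrite leNgt; apply/negP => px0.
have Xx0 : X < x0 by exact: lt_le_trans Nx0.
have x00 : 0 < x0 by exact: le_lt_trans Xx0.
(* The bound is assumed strictly before [z], so that [key] applies at a first point where [dsigma]
   would reach [L]. *)
have key z : x0 <= z -> (forall u, x0 <= u -> u < z -> dsigma u < L) ->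
    dsigma z <= dsigma x0 - L ^+ 2 * (z - x0).
  move=> x0z hu.
  have Xz : X <= z by rewrite (le_trans (ltW Xx0)).
  have [iz ->] := dd Xz; have [_ ->] := dd (ltW Xx0).
  have Xx0' : (BLeft X <= BRight x0)%O by rewrite bnd_simp ltW.
  have x0z' : (BRight x0 <= BRight z)%O by rewrite bnd_simp.
  have i1 : mu.-integrable `]x0, z] (EFin \o d2sigma).
    apply: integrableS iz => //= u; rewrite /= !in_itv/= => /andP[h1 h2].
    by apply/andP; split; lra.
  have i2 : mu.-integrable `[x0, z[ (EFin \o d2sigma).
    apply: integrableS iz => //= u; rewrite /= !in_itv/= => /andP[h1 h2].
    by apply/andP; split; lra.
  have := Rintegral_itvB iz Xx0' x0z'.
  rewrite (Rintegral_itv_obnd_cbnd i1) -(Rintegral_itv_bndo_bndc i2) => E.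
  have : \int[mu]_(x in `[x0, z[) d2sigma x <= \int[mu]_(x in `[x0, z[) (- L ^+ 2).
    apply: le_Rintegral => //.
      have ic : mu.-integrable `[x0, z] (EFin \o (fun=> - L ^+ 2)).
        apply: continuous_compact_integrable; first exact: segment_compact.
        by apply: continuous_subspaceT => u; exact: cst_continuous.
      apply: integrableS ic => //= u; rewrite /= !in_itv/= => /andP[h1 h2].
      by apply/andP; split; lra.
    move=> u /=; rewrite in_itv/= => /andP[x0u uz].
    have := MP u (lt_le_trans MN (le_trans Nx0 x0u)).
    have uL := hu u x0u uz; have cu := sc (le_trans (ltW x00) x0u).
    have : dsigma u ^+ 2 <= L ^+ 2.
      by rewrite ler_pXn2r ?nnegrE ?(ltW L0) ?(ltW uL)// (le_trans (ltW c0)).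
    lra.
  rewrite Rintegral_cst// [fine _](_ : _ = z - x0); first lra.
  transitivity (fine (if (x0 < z)%R then z%:E - x0%:E else 0)%E).
    by congr fine; apply: etrans (lebesgue_measure_itv _) _; rewrite /= lte_fin.
  by case: ltP => // zx; apply/esym/eqP; rewrite subr_eq0 eq_le zx.
(* At the infimum of the points where [dsigma] is at least [L], continuity gives [L <= dsigma] and
   [key] gives [dsigma <= dsigma x0 < L]. *)
have p_lt y : x0 <= y -> dsigma y < L.
  move=> x0y; rewrite ltNge; apply/negP => Ly.
  pose A := [set u | x0 <= u /\ L <= dsigma u].
  have A0 : has_inf A by split; [exists y|exists x0 => u []].
  have Ax0 : x0 <= inf A by apply: lb_le_inf; [exact: A0.1|move=> u []].
  have pz : L <= dsigma (inf A).
    rewrite leNgt; apply/negP => pz.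
    have cz := C1_half_line_continuous sC (lt_le_trans x00 Ax0).
    have [e /= e0 eP] : \forall u \near inf A, dsigma u < L.
      exact: cvgr_lt cz _ pz.
    have [u Au ue] := inf_adherent e0 A0.
    have zu : inf A <= u by apply: ge_inf => //; exact: A0.2.
    have := eP u; rewrite /= ltr_distlC => h; have := Au.2; rewrite leNgt h//.
    by rewrite ue andbT (lt_le_trans _ zu)// ltrBlDr ltrDl.
  have := key (inf A) Ax0.
  have h u : x0 <= u -> u < inf A -> dsigma u < L.
    move=> x0u; rewrite ltNge => /negP uA; rewrite ltNge; apply/negP => Lu.
    by apply: uA; apply: ge_inf; [exact: A0.2|].
  move=> /(_ h) k1; have : 0 <= L ^+ 2 * (inf A - x0) by rewrite mulr_ge0 ?sqr_ge0 ?subr_ge0.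
  lra.
(* Over a length [1 / L] the drop is at least [L], more than [dsigma x0], so [dsigma] would become
   negative. *)
have z0 : x0 <= x0 + L^-1 by rewrite lerDl invr_ge0 ltW.
have := key (x0 + L^-1) z0 (fun u ux _ => p_lt u ux).
rewrite addrAC subrr add0r expr2 -mulrA mulfV ?gt_eqF// mulr1.
move=> h1; have := le_trans (sc (le_trans (ltW x00) z0)) h1; move: px0 c0; lra.
Qed.

End Unbounded.

(** The two-sided bound gives [phi x / phi s <= c2 / c1 * expR (sigma s - sigma x)], and a lower
    bound [L] on [dsigma] becomes the rate of decay [L]. *)
Lemma decaying_of_bounds (phi sigma dsigma : R -> R) (c c1 c2 : R) :
  square_integrable half_line phi -> C1_half_line sigma dsigma ->
  0 < c -> 0 < c1 -> 0 < c2 ->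
  (forall x, 0 < x ->
     c1 * expR (- sigma x) <= phi x /\ phi x <= c2 * expR (- sigma x)) ->
  (forall x, 0 <= x -> c <= dsigma x) ->
  (forall L, 0 < L -> exists N, forall x, N <= x -> L <= dsigma x) ->
  decaying phi (c2 / c1) c.
Proof.
move=> sphi sC c0 c10 c20 bnd sc sL.
have main L s x : L * (x - s) <= sigma x - sigma s -> 0 < s -> s <= x ->
    phi x <= c2 / c1 * expR (- (L * (x - s))) * phi s.
  move=> Ls s0 sx; have [_ ux] := bnd x (lt_le_trans s0 sx); have [ls _] := bnd s s0.
  apply: le_trans ux _.
  apply: (@le_trans _ _ (c2 / c1 * expR (- (L * (x - s))) * (c1 * expR (- sigma s)))); last first.
    by rewrite ler_wpM2l// mulr_ge0 ?expR_ge0// divr_ge0// ltW.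
  rewrite [leRHS](_ : _ = c2 * expR (- (L * (x - s)) - sigma s)); last first.
    by rewrite expRD; field; rewrite gt_eqF.
  by rewrite ler_pM2l// ler_expR; lra.
split => //.
- by move=> x x0; have [+ _] := bnd x x0; apply: lt_le_trans; rewrite mulr_gt0 ?expR_gt0.
- exact: divr_gt0.
- move=> s x s0 sx; apply: main => //.
  by apply: (C1_half_line_growth (N := 0) sC) => //; [move=> y _; exact: sc|exact: ltW].
- move=> L L0; have [N NP] := sL L L0; exists N => s x Ns s0 sx; apply: main => //.
  by apply: (C1_half_line_growth (N := N) sC) => // y Ny _; exact: NP.
Qed.

Lemma square_integrable_expN (phi sigma dsigma : R -> R) (c1 : R) :
  square_integrable half_line phi -> C1_half_line sigma dsigma -> 0 < c1 ->
  (forall x, 0 < x -> c1 * expR (- sigma x) <= phi x) ->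
  square_integrable half_line (fun x => expR (- sigma x)).
Proof.
move=> [mphi iphi] sC c10 bnd.
have mE : measurable_fun half_line (fun x => expR (- sigma x)).
  apply: open_continuous_measurable_fun => [|x]; first exact: interval_open.
  rewrite inE /half_line /= in_itv/= andbT => x0.
  apply: continuous_comp; last exact: continuous_expR.
  apply: cvgN; apply: differentiable_continuous; apply/derivable1_diffP.
  by have := C1_half_line_is_derive sC x0 => -[].
split => //.
have mH : measurable (@half_line R : set (g_sigma_algebraType R.-ocitv.-measurable)).
  exact: measurable_itv.
have := integrableZl mH ((c1 ^+ 2)^-1) iphi.
apply: le_integrable => //.
  by apply/measurable_EFinP; exact: measurable_funX.
move=> x; rewrite /half_line /= in_itv/= andbT => x0.
rewrite lee_fin !ger0_norm ?sqr_ge0//; last first.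
  by rewrite mulr_ge0 ?invr_ge0 ?sqr_ge0.
rewrite ler_pdivlMl ?exprn_gt0// -exprMn ler_pXn2r// ?nnegrE.
- exact: bnd.
- by rewrite mulr_ge0 ?expR_ge0// ltW.
- by rewrite (le_trans _ (bnd _ x0))// mulr_ge0 ?expR_ge0// ltW.
Qed.

End Growth.

(** * Coefficients of complex functions *)

Section Coefficients.
Local Open Scope complex_scope.
Context {R : realType}.
Notation mu := (@lebesgue_measure R).
Local Notation V := (@hl2 R).
Local Notation dot := (@hl2_dot R).
Implicit Types (u v : R -> R) (f g : R -> R[i]).

Lemma restrict_hl2 u : square_integrable half_line u ->
  u \_ half_line \in hl2_pred.
Proof.
move=> [mu_ iu]; apply: hl2P.
- split; first exact: (measurable_restrictT u measurable_half_line).1.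
  have mH : measurable (@half_line R : set (g_sigma_algebraType R.-ocitv.-measurable)).
    exact: measurable_itv.
  have := (integrable_mkcond _ mH).1 iu.
  apply: eq_integrable => // x _ /=.
  by rewrite !patchE; case: ifP; rewrite //= expr0n.
- move=> x x0; rewrite patchE memNset// /half_line /= in_itv/= andbT.
  by apply/negP; rewrite -leNgt.
Qed.

(** Total, with value [0] when [u] is not square-integrable, so that [ReV] and [ImV] accept every
    function. *)
Definition to_hl2 u : V := insubd (0 : V) (u \_ half_line).

Lemma to_hl2E u : square_integrable half_line u -> to_hl2 u = u \_ half_line :> (R -> R).
Proof. by move=> su; rewrite /to_hl2 val_insubd restrict_hl2. Qed.

Lemma hl2_square_integrable (w : V) u : (forall x, 0 < x -> u x = w x) ->
  square_integrable half_line u /\ to_hl2 u = w.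
Proof.
move=> uw.
have uwE : u \_ half_line = w.
  apply/funext => x; rewrite patchE /half_line mem_setE in_itv/= andbT.
  by case: ltP => x0; [exact: uw|rewrite hl2_le0].
have [mw iw] := hl2_sqint w.
have mH : measurable (@half_line R : set (g_sigma_algebraType R.-ocitv.-measurable)).
  exact: measurable_itv.
have su : square_integrable half_line u.
  split; first by apply/(measurable_restrictT u measurable_half_line); rewrite uwE.
  apply/(integrable_mkcond _ mH); apply: eq_integrable iw => // x _ /=.
  by rewrite -uwE !patchE; case: ifP; rewrite //= expr0n.
by split => //; apply: val_inj; rewrite /= to_hl2E.
Qed.

Lemma to_hl2_ae u v : square_integrable half_line u -> square_integrable half_line v ->
  ae_eq mu half_line u v <->
  dot (to_hl2 u - to_hl2 v) (to_hl2 u - to_hl2 v) = 0.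
Proof.
move=> su sv; set w := to_hl2 u - to_hl2 v.
have wE x : half_line x -> w x = u x - v x.
  by move=> xH; rewrite hl2BE !to_hl2E// !patchE mem_set.
have aeF := ae_filter_ringOfSetsType mu.
split=> [uv|/hl2_dot_eq0 w0].
  have [mw _] := hl2_sqint w.
  rewrite hl2_dotE (ae_eq_Rintegral (g := fun=> 0)) ?Rintegral_cst ?mul0r//.
    exact: measurable_funX.
  apply: filterS uv => x uvx _.
  have [xH|xH] := pselect (half_line x).
    by rewrite wE// uvx// subrr expr0n.
  rewrite hl2_le0 ?expr0n// leNgt; apply/negP => x0; apply: xH.
  by rewrite /half_line /= in_itv/= x0.
by apply: filterS w0 => x wx xH; apply/eqP; rewrite -subr_eq0 -wE// wx.
Qed.

Lemma to_hl2_lin (a b : R) u v w : square_integrable half_line u ->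
  square_integrable half_line v -> square_integrable half_line w ->
  square_integrable half_line (fun x => a * u x + b * v x + w x) /\
  to_hl2 (fun x => a * u x + b * v x + w x) = a *: to_hl2 u + b *: to_hl2 v + to_hl2 w.
Proof.
move=> su sv sw; apply: hl2_square_integrable => x x0.
rewrite !hl2DE !hl2ZE !to_hl2E// !patchE mem_set//.
by rewrite /half_line /= in_itv/= x0.
Qed.

Definition ReV f : V := to_hl2 (fun x => complex.Re (f x)).
Definition ImV f : V := to_hl2 (fun x => complex.Im (f x)).

Lemma L2_lin (a : R[i]) f g : L2 f -> L2 g ->
  [/\ L2 (fun x => a * f x + g x),
      ReV (fun x => a * f x + g x) =
        complex.Re a *: ReV f + (- complex.Im a) *: ImV f + ReV g
    & ImV (fun x => a * f x + g x) =
        complex.Re a *: ImV f + complex.Im a *: ReV f + ImV g].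
Proof.
move=> [rf jf] [rg jg]; case: a => a b /=.
have [r1 r2] := to_hl2_lin a (- b) rf jf rg.
have [j1 j2] := to_hl2_lin a b jf rf jg.
have rE : (fun x => complex.Re ((a +i* b) * f x + g x)) =
    fun x => a * complex.Re (f x) + - b * complex.Im (f x) + complex.Re (g x).
  by apply/funext => x; case: (f x) (g x) => [? ?] [? ?] /=; rewrite mulNr.
have jE : (fun x => complex.Im ((a +i* b) * f x + g x)) =
    fun x => a * complex.Im (f x) + b * complex.Re (f x) + complex.Im (g x).
  by apply/funext => x; case: (f x) (g x) => [? ?] [? ?] /=.
by rewrite /L2 /ReV /ImV rE jE; split.
Qed.

Lemma L2_of_hl2 (u v : V) :
  [/\ L2 (fun x => u x +i* v x), ReV (fun x => u x +i* v x) = u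
    & ImV (fun x => u x +i* v x) = v].
Proof.
have [r1 r2] := @hl2_square_integrable u u (fun _ _ => erefl).
have [j1 j2] := @hl2_square_integrable v v (fun _ _ => erefl).
by split.
Qed.

Lemma L2norm_sqr f : L2 f ->
  L2norm f = Num.sqrt (dot (ReV f) (ReV f) + dot (ImV f) (ImV f)).
Proof.
move=> [rf jf]; rewrite /L2norm; congr Num.sqrt.
rewrite Rintegral_mkcond !hl2_dotE -RintegralD//; last 2 first.
- by have [] := hl2_sqint (ReV f).
- by have [] := hl2_sqint (ImV f).
apply: eq_Rintegral => x _; rewrite /ReV /ImV !to_hl2E// !patchE.
by case: ifP; rewrite // expr0n addr0.
Qed.

Lemma L2eqP f g : L2 f -> L2 g -> L2eq f g <->
  dot (ReV f - ReV g) (ReV f - ReV g) = 0 /\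
  dot (ImV f - ImV g) (ImV f - ImV g) = 0.
Proof.
move=> [rf jf] [rg jg]; have aeF := ae_filter_ringOfSetsType mu.
rewrite -(to_hl2_ae rf rg) -(to_hl2_ae jf jg); split=> [fg|[rfg jfg]].
  by split; apply: filterS fg => x h /h ->.
apply: filterS2 rfg jfg => x h1 h2 xH; apply/eqP; rewrite eq_complex.
by rewrite h1// h2// !eqxx.
Qed.

(** * Coefficients in a real eigenbasis *)

Section Basis.
Variables (a : V -> V -> R) (e : nat -> V).
Hypothesis eS : spectral_basis dot a e.

Definition coef f n : R[i] := dot (e n) (ReV f) +i* dot (e n) (ImV f).

Lemma coef_lin (z : R[i]) f g n : L2 f -> L2 g ->
  coef (fun x => z * f x + g x) n = z * coef f n + coef g n.
Proof.
move=> Lf Lg; rewrite /coef; have [_ -> ->] := L2_lin z Lf Lg.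
case: z => x y; apply/eqP; rewrite eq_complex /=.
rewrite !(formDr hl2_dot_psd) !(formZr hl2_dot_psd).
by rewrite mulNr !eqxx.
Qed.

Lemma L2_0 : L2 (fun=> 0 : R[i]).
Proof. by have [] := L2_of_hl2 0 0. Qed.

Lemma coef_0 n : coef (fun=> 0) n = 0.
Proof.
have [_ r j] := L2_of_hl2 0 0; rewrite /coef.
rewrite (_ : ReV (fun=> 0) = 0)// (_ : ImV (fun=> 0) = 0)//.
by rewrite (form_sym hl2_dot_psd) (form0l hl2_dot_psd).
Qed.

Lemma L2Z (z : R[i]) f : L2 f -> L2 (fun x => z * f x).
Proof.
move=> Lf; have [+ _ _] := L2_lin z Lf L2_0.
by under eq_fun do rewrite addr0.
Qed.

Lemma coefZ (z : R[i]) f n : L2 f -> coef (fun x => z * f x) n = z * coef f n.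
Proof.
move=> Lf; have := coef_lin z n Lf L2_0.
by rewrite coef_0 addr0; under eq_fun do rewrite addr0.
Qed.

Lemma L2_sum (m : nat) (b : 'I_m -> R[i]) (F : 'I_m -> R -> R[i]) :
  (forall i, L2 (F i)) ->
  L2 (fun x => \sum_(i < m) b i * F i x) /\
  forall n, coef (fun x => \sum_(i < m) b i * F i x) n = \sum_(i < m) b i * coef (F i) n.
Proof.
move=> LF; elim: m => [|m ih] in b F LF *.
  have E : (fun x => \sum_(i < 0) b i * F i x) = fun=> 0.
    by apply/funext => x; rewrite big_ord0.
  by rewrite E; split; [exact: L2_0|move=> n; rewrite coef_0 big_ord0].
have E : (fun x => \sum_(i < m.+1) b i * F i x) =
    fun x => b ord0 * F ord0 x + \sum_(i < m) b (lift ord0 i) * F (lift ord0 i) x.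
  by apply/funext => x; rewrite big_ord_recl.
have [L1 c1] := ih (fun i => b (lift ord0 i)) (fun i => F (lift ord0 i)) (fun i => LF _).
rewrite E; split=> [|n]; first by have [] := L2_lin (b ord0) (LF ord0) L1.
by rewrite coef_lin// c1 big_ord_recl.
Qed.

(** Turns almost everywhere equality, and with it the graph of [Hop], into scalar equations. *)
Lemma L2eq_coef f g : L2 f -> L2 g -> L2eq f g <-> forall n, coef f n = coef g n.
Proof.
move=> Lf Lg; rewrite L2eqP//; split=> [[h1 h2] n|fg].
  rewrite /coef; congr (_ +i* _); apply/eqP; rewrite -subr_eq0 -(formBr hl2_dot_psd).
    by rewrite (form_sym hl2_dot_psd) (form_eq0 hl2_dot_psd).
  by rewrite (form_sym hl2_dot_psd) (form_eq0 hl2_dot_psd).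
by split; apply: (sb_total eS) => n; rewrite (formBr hl2_dot_psd);
  case: (fg n) => h1 h2; apply/eqP; rewrite subr_eq0; apply/eqP.
Qed.

(** The squared modulus as a real number; the norm of [R[i]] takes values in [R[i]]. *)
Definition sqnorm (z : R[i]) : R := complex.Re z ^+ 2 + complex.Im z ^+ 2.

Lemma coef_parseval f : L2 f ->
  \sum_(i < n) sqnorm (coef f i) @[n --> \oo] --> L2norm f ^+ 2.
Proof.
move=> Lf; rewrite L2norm_sqr// sqr_sqrtr ?addr_ge0 ?(form_ge0 hl2_dot_psd)//.
have eO := sb_orthonormal eS; have eT := sb_total eS.
have h1 := parseval hl2_dot_psd (v := ReV f) hl2_complete eO eT.
have h2 := parseval hl2_dot_psd (v := ImV f) hl2_complete eO eT.
rewrite (_ : (fun n => \sum_(i < n) sqnorm (coef f i)) = fun n =>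
    \sum_(i < n) dot (e i) (ReV f) ^+ 2 + \sum_(i < n) dot (e i) (ImV f) ^+ 2).
  exact: cvgD h1 h2.
by apply/funext => n; rewrite -big_split.
Qed.

Lemma coef_surj (c : nat -> R[i]) (B : R) :
  (forall n, \sum_(i < n) sqnorm (c i) <= B) -> exists2 f, L2 f & coef f =1 c.
Proof.
move=> cB; have eO := sb_orthonormal eS.
have [|u [_ uE]] := riesz_fischer hl2_dot_psd
    (a := fun n => complex.Re (c n)) (C := B) hl2_complete eO.
  by move=> n; apply: le_trans (cB n); apply: ler_sum => i _; rewrite lerDl sqr_ge0.
have [|v [_ vE]] := riesz_fischer hl2_dot_psd
    (a := fun n => complex.Im (c n)) (C := B) hl2_complete eO.
  by move=> n; apply: le_trans (cB n); apply: ler_sum => i _; rewrite lerDr sqr_ge0.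
have [Lf r j] := L2_of_hl2 u v.
exists (fun x => u x +i* v x) => // n.
by rewrite /coef r j uE vE; case: (c n).
Qed.

End Basis.

(** The real kernel acts on both parts separately, and moving [K^*] to the other side turns
    [<e n, K^* K w>] into [green_form D (e n) w]. *)
Lemma Gop_coef phi kappa c (D : decaying phi kappa c) e f :
  spectral_basis dot (green_form D) e -> L2 f ->
  L2 (Gop phi f) /\
  forall n, coef e (Gop phi f) n = (green_form D (e n) (e n))%:C * coef e f n.
Proof.
move=> eS [rf jf].
have val_on w : square_integrable half_line w -> {in half_line, w =1 to_hl2 w}.
  by move=> sw x xH; rewrite to_hl2E// patchE xH.
have [r1 r2] : square_integrable half_line (fun x => complex.Re (Gop phi f x)) /\
    to_hl2 (fun x => complex.Re (Gop phi f x)) = greenKt D (greenK D (ReV f)).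
  apply: hl2_square_integrable => x x0.
  rewrite -(Gop_greenK D x0 (val_on _ rf)) /=; apply: eq_Rintegral => y _.
  by case: (f y) => ? ?; rewrite /= mul0r subr0.
have [j1 j2] : square_integrable half_line (fun x => complex.Im (Gop phi f x)) /\
    to_hl2 (fun x => complex.Im (Gop phi f x)) = greenKt D (greenK D (ImV f)).
  apply: hl2_square_integrable => x x0.
  rewrite -(Gop_greenK D x0 (val_on _ jf)) /=; apply: eq_Rintegral => y _.
  by case: (f y) => ? ?; rewrite /= mul0r addr0.
have key n w : dot (e n) (greenKt D (greenK D w)) =
    green_form D (e n) (e n) * dot (e n) w.
  by rewrite -greenK_adjoint; exact: (sb_eigen eS n w).
split => // n; rewrite /coef /ReV /ImV r2 j2 !key.
apply/eqP; rewrite eq_complex /=.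
by rewrite !mul0r subr0 addr0 !eqxx.
Qed.

End Coefficients.

(** * The spectrum *)

Section Spectrum.
Local Open Scope complex_scope.
Context {R : realType}.
Local Notation V := (@hl2 R).
Local Notation dot := (@hl2_dot R).
Implicit Types (f g : R -> R[i]) (z w : R[i]).
Context (phi : R -> R) (kappa c : R) (D : decaying phi kappa c).
Context (e : nat -> V) (eS : spectral_basis dot (green_form D) e).

Let mu_ n : R := green_form D (e n) (e n).
Definition green_eigenvalue n : R := (green_form D (e n) (e n))^-1.
Local Notation lam := green_eigenvalue.

Let mu_gt0 n : 0 < mu_ n. Proof. exact: (sb_gt0 eS). Qed.

Lemma green_eigenvalue_homo : {homo lam : m n / (m <= n)%N >-> m <= n}.
Proof.
by move=> m n mn; rewrite lef_pV2 ?posrE ?(sb_gt0 eS)// (sb_homo eS).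
Qed.

Lemma green_eigenvalue_unbounded (B : R) : exists N, forall n, (N <= n)%N -> B < lam n.
Proof.
have B0 : 0 < `|B| + 1 by rewrite ltr_pwDr.
have [|N NB] := sb_cvg0 eS (eps := (`|B| + 1)^-1); first by rewrite invr_gt0.
exists N => n Nn; apply: lt_le_trans (green_eigenvalue_homo Nn).
apply: (@lt_trans _ _ (`|B| + 1)); first by rewrite ltr_pwDr// ler_norm.
by rewrite -[ltLHS]invrK ltf_pV2 ?posrE ?invr_gt0// (sb_gt0 eS).
Qed.

Let mulam n : (mu_ n)%:C * (lam n)%:C = 1.
Proof. by rewrite -rmorphM /= mulfV ?gt_eqF// mu_gt0. Qed.

Lemma HopP g f : Hop phi g f <->
  [/\ L2 g, L2 f & forall n, coef e g n = (green_form D (e n) (e n))%:C * coef e f n].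
Proof.
split=> [[Lg Lf]|[Lg Lf gf]]; have [LG cG] := Gop_coef eS Lf.
  by move/(L2eq_coef eS Lg LG) => h; split => // n; rewrite h cG.
by split => //; apply/(L2eq_coef eS Lg LG) => n; rewrite gf cG.
Qed.

(** One coefficient of the equation [g = G (f + z g)] that [shift_op] expresses. *)
Let resolvent_coef n z (x y : R[i]) :
  y = (mu_ n)%:C * (x + z * y) <-> ((lam n)%:C - z) * y = x.
Proof.
split=> [h|<-]; last by rewrite mulrBl subrK mulrA mulam mul1r.
by rewrite mulrBl {1}h mulrA (mulrC (lam n)%:C) mulam mul1r addrK.
Qed.

Lemma eigenspaceP z g : op_eigenspace (Hop phi) z g <->
  L2 g /\ forall n, (lam n)%:C != z -> coef e g n = 0.
Proof.
rewrite /op_eigenspace /= HopP; split=> [[Lg _ gE]|[Lg gE]].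
  split => // n nz; have := gE n; rewrite coefZ// -[z * _]add0r.
  move/resolvent_coef/eqP; rewrite mulf_eq0 subr_eq0 (negbTE nz)/=.
  by move/eqP.
split => //; first exact: L2Z.
move=> n; rewrite coefZ// -[z * _]add0r; apply/resolvent_coef.
have [->|/gE ->] := eqVneq (lam n)%:C z; first by rewrite subrr mul0r.
by rewrite mulr0.
Qed.

Let basis_fun k : R -> R[i] := fun x => e k x +i* (0 : V) x.

Let basis_fun_L2 k : L2 (basis_fun k).
Proof. by have [] := L2_of_hl2 (e k) 0. Qed.

Let basis_fun_coef k n : coef e (basis_fun k) n = (n == k)%:R.
Proof.
have [_ r j] := L2_of_hl2 (e k) 0; rewrite /coef r j (sb_orthonormal eS).
rewrite (form_sym hl2_dot_psd) (form0l hl2_dot_psd).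
by case: eqP.
Qed.

(** Beyond some rank [lam] exceeds the real part of [z], so finitely many indices have to be
    tested. *)
Lemma eigenvalue_indices z : exists2 s : seq nat, uniq s &
  forall k, (k \in s) = ((lam k)%:C == z).
Proof.
have [N NP] := green_eigenvalue_unbounded (complex.Re z).
exists [seq k <- iota 0 N | (lam k)%:C == z]; first by rewrite filter_uniq ?iota_uniq.
move=> k; rewrite mem_filter mem_iota /= add0n andb_idr// => /eqP kz.
by rewrite ltnNge; apply/negP => /NP; rewrite -kz /= ltxx.
Qed.

Lemma eigenspace_dim z (s : seq nat) : uniq s ->
  (forall k, (k \in s) = ((lam k)%:C == z)) ->
  has_dim (op_eigenspace (Hop phi) z) (size s).
Proof.
move=> us sP; pose E (i : 'I_(size s)) := basis_fun (nth 0%N s i).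
have LE i : L2 (E i) by exact: basis_fun_L2.
have cE i n : coef e (E i) n = (n == nth 0%N s i)%:R by exact: basis_fun_coef.
have sum_coef (a : 'I_(size s) -> R[i]) (i : 'I_(size s)) :
    \sum_(j < size s) a j * coef e (E j) (nth 0%N s i) = a i.
  rewrite (bigD1 i)//= cE eqxx mulr1 big1 ?addr0// => j ji.
  by rewrite cE nth_uniq// eq_sym (inj_eq val_inj) (negbTE ji) mulr0.
exists E; split=> [i|a aE i|g /eigenspaceP[Lg gE]].
- apply/eigenspaceP; split => // n nz; rewrite cE; case: eqP => // nE.
  by move: nz; rewrite nE -sP mem_nth.
- have [La ca] := L2_sum e a LE.
  have := (L2eq_coef eS La L2_0).1 aE (nth 0%N s i).
  by rewrite ca sum_coef coef_0.
- exists (fun i => coef e g (nth 0%N s i)).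
  have [La ca] := L2_sum e (fun i => coef e g (nth 0%N s i)) LE.
  apply/(L2eq_coef eS Lg La) => n; rewrite ca.
  have [ns|ns] := boolP (n \in s).
    have ni : (index n s < size s)%N by rewrite index_mem.
    by have := sum_coef (fun i => coef e g (nth 0%N s i)) (Ordinal ni); rewrite /= nth_index.
  rewrite gE -?sP// big1// => i _; rewrite cE; case: eqP => [nE|]; last by rewrite mulr0.
  by move: ns; rewrite nE mem_nth.
Qed.

Lemma green_eigenvalue_enumeration : eigenvalue_enumeration (Hop phi) lam.
Proof.
split; first exact: green_eigenvalue_homo.
move=> z; have [s us sP] := eigenvalue_indices z.
exists (size s); first exact: eigenspace_dim.
apply/card_set_bijP; exists (index^~ s); split.
- by move=> k /= /eqP; rewrite -sP index_mem.
- move=> k l /=; rewrite !inE /= => /eqP; rewrite -sP => ks /eqP; rewrite -sP => ls.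
  by move=> /(congr1 (nth 0%N s)); rewrite !nth_index.
- move=> i /= is_; exists (nth 0%N s i); last by rewrite index_uniq.
  by apply/eqP; rewrite -sP mem_nth.
Qed.

Let finite_gap (P : pred nat) (d : nat -> R) N : (forall n, P n -> 0 < d n) ->
  exists2 delta, 0 < delta & forall n, (n < N)%N -> P n -> delta <= d n.
Proof.
move=> Pd; elim: N => [|N [del del0 delP]]; first by exists 1.
have [PN|PN] := boolP (P N).
  exists (Num.min del (d N)); first by rewrite lt_min del0 Pd.
  move=> n; rewrite ltnS leq_eqVlt => /predU1P[-> _|nN Pn].
    by rewrite ge_min lexx orbT.
  by rewrite ge_min delP.
exists del => // n; rewrite ltnS leq_eqVlt => /predU1P[->|nN Pn]; last exact: delP.
by rewrite (negbTE PN).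
Qed.

(** Far out [lam n] exceeds the real part of [z] by more than [1]; the other indices are finite in
    number. The gap serves both to bound the resolvent and to isolate eigenvalues. *)
Lemma eigenvalue_gap z : exists2 delta, 0 < delta &
  forall n, (lam n)%:C != z -> delta <= sqnorm ((lam n)%:C - z).
Proof.
have [N NP] := green_eigenvalue_unbounded (complex.Re z + 1).
have [|del del0 delP] := @finite_gap (fun n => (lam n)%:C != z)
    (fun n => sqnorm ((lam n)%:C - z)) N.
  move=> n; rewrite -subr_eq0 /sqnorm; case: (_ - z) => x y.
  rewrite eq_complex /= negb_and => /orP[h|h].
    by rewrite ltr_pwDl ?sqr_ge0// lt_neqAle eq_sym sqrf_eq0 h sqr_ge0.
  by rewrite ltr_wpDl ?sqr_ge0// lt_neqAle eq_sym sqrf_eq0 h sqr_ge0.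
exists (Num.min del 1); first by rewrite lt_min del0 ltr01.
move=> n nz; rewrite ge_min; have [nN|/NP h] := ltnP n N.
  by rewrite delP.
apply/orP; right; rewrite /sqnorm; case: z h {nz delP NP} => x y /= h.
have := sqr_ge0 (0 - y); have : 1 <= (lam n - x) ^+ 2 by nra.
by move=> h1 h2; rewrite -[leLHS]addr0 lerD.
Qed.

Let sqnormM z w : sqnorm (z * w) = sqnorm z * sqnorm w.
Proof. by case: z w => [a b] [a' b']; rewrite /sqnorm /=; ring. Qed.

Let sqnorm_ge0 z : 0 <= sqnorm z.
Proof. by rewrite addr_ge0 ?sqr_ge0. Qed.

Let shift_coef z f g : L2 f -> L2 g ->
  L2 (fun x => f x + z * g x) /\
  forall n, coef e (fun x => f x + z * g x) n = coef e f n + z * coef e g n.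
Proof.
move=> Lf Lg.
rewrite (_ : (fun x => f x + z * g x) = fun x => z * g x + f x); last first.
  by apply/funext => x; rewrite addrC.
by have [L1 _ _] := L2_lin z Lg Lf; split => // n; rewrite coef_lin// addrC.
Qed.

(** Coefficients are divided by [lam n - z]. The gap keeps the quotients square-summable, so
    Riesz-Fischer provides a preimage and Parseval the bound on the inverse. *)
Lemma resolvent_setP z : (forall n, (lam n)%:C != z) -> resolvent_set (Hop phi) z.
Proof.
move=> zn; have [del del0 delP] := eigenvalue_gap z.
have quot n (x y : R[i]) : ((lam n)%:C - z) * y = x -> sqnorm y <= del^-1 * sqnorm x.
  move=> <-; rewrite sqnormM mulrA -[leLHS]mul1r ler_wpM2r// -(mulVf (lt0r_neq0 del0)).
  by rewrite ler_wpM2l ?invr_ge0 ?(ltW del0)// delP.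
split=> [f Lf|].
  pose cf n := coef e f n / ((lam n)%:C - z).
  have cfE n : ((lam n)%:C - z) * cf n = coef e f n.
    by rewrite /cf mulrC mulfVK// subr_eq0 zn.
  have Pf := coef_parseval eS Lf.
  have [|g Lg gE] := @coef_surj _ _ _ eS cf (del^-1 * L2norm f ^+ 2).
    move=> n; apply: (@le_trans _ _ (del^-1 * \sum_(i < n) sqnorm (coef e f i))).
      by rewrite mulr_sumr; apply: ler_sum => i _; exact: quot (cfE i).
    rewrite ler_wpM2l ?invr_ge0 ?(ltW del0)//.
    have nd : nondecreasing_seq (fun n => \sum_(i < n) sqnorm (coef e f i)).
      by apply/nondecreasing_seqP => k; rewrite big_ord_recr /= lerDl sqnorm_ge0.
    by have := nondecreasing_cvgn_le nd (cvgP _ Pf) n; rewrite (cvg_lim _ Pf).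
  have [Lfg cfg] := shift_coef z Lf Lg.
  exists g; apply/HopP; split => // n; rewrite cfg.
  by apply/resolvent_coef; rewrite gE.
exists (Num.sqrt del^-1) => g f /HopP[Lg Lfg gE].
have Lf : L2 f.
  have [+ _ _] := L2_lin (- z) Lg Lfg; congr L2; apply/funext => x.
  by rewrite mulNr addrCA addNr addr0.
have [_ cfg] := shift_coef z Lf Lg.
have cfE n : ((lam n)%:C - z) * coef e g n = coef e f n.
  by apply/resolvent_coef; rewrite -cfg -gE.
have Pf := coef_parseval eS Lf; have Pg := coef_parseval eS Lg.
have : L2norm g ^+ 2 <= del^-1 * L2norm f ^+ 2.
  have Pf' : del^-1 * \sum_(i < n) sqnorm (coef e f i) @[n --> \oo] --> del^-1 * L2norm f ^+ 2.
    by apply: cvgM => //; exact: cvg_cst.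
  apply: ler_cvg_to Pg Pf' _; apply: nearW => n.
  by rewrite mulr_sumr; apply: ler_sum => i _; exact: quot (cfE i).
have [nf ng] : 0 <= L2norm f /\ 0 <= L2norm g by rewrite !sqrtr_ge0.
rewrite -[X in X * _ ^+ 2]sqr_sqrtr ?invr_ge0 ?(ltW del0)// -exprMn.
by rewrite ler_pXn2r ?nnegrE ?mulr_ge0 ?sqrtr_ge0.
Qed.

Theorem essential_spectrum_eq0 : essential_spectrum (Hop phi) = set0.
Proof.
apply/seteqP; split=> // z [zspec]; apply.
have [k kz] : exists k, (lam k)%:C = z.
  apply: contrapT => /forallNP nz; apply: zspec; apply: resolvent_setP => n.
  by apply/eqP; exact: nz.
split.
  have [del del0 delP] := eigenvalue_gap z.
  (* The gap bounds a squared distance, hence the root. *)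
  exists (Num.sqrt del); first by rewrite sqrtr_gt0.
  move=> w wz wzd; apply: resolvent_setP => n; apply/eqP => nw.
  have := delP n; rewrite nw => /(_ wz).
  move: wzd; rewrite normc_def ltcR ltr_sqrt// /sqnorm => h1 h2.
  by move: (lt_le_trans h1 h2); rewrite ltxx.
have [s us sP] := eigenvalue_indices z.
exists (size s); last exact: eigenspace_dim.
by have := sP k; rewrite kz eqxx; case: (s).
Qed.

End Spectrum.

(** * Comparison of eigenvalues *)

Section Comparison.
Context {R : realType}.
Notation mu := (@lebesgue_measure R).
Local Notation V := (@hl2 R).
Local Notation dot := (@hl2_dot R).
Context (phi phi' : R -> R) (kappa kappa' c c' p q : R).
Context (D : decaying phi kappa c) (D' : decaying phi' kappa' c').
Hypothesis p0 : 0 < p.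
Hypothesis pq : forall x, 0 < x -> p * phi' x <= phi x /\ phi x <= q * phi' x.

Let m (x : R) := phi0 phi x * (phi0 phi' x)^-1.

Let m_pos x : 0 < x -> p <= m x /\ m x <= q.
Proof.
move=> x0; rewrite /m !phi0_pos//; have p'0 := dec_gt0 D' x0.
by rewrite ler_pdivlMr// ler_pdivrMr//; exact: pq.
Qed.

Let mul_hl2 (f : V) : (fun x => m x * f x) \in hl2_pred.
Proof.
apply: hl2P; last by move=> x x0; rewrite hl2_le0// mulr0.
apply: le_sqint (sqintZ q (hl2_sqint f)).
  apply: measurable_funM; last by case: (hl2_sqint f).
  by apply: measurable_funM; [exact: phi0_measurable D|exact: phi0V_measurable D'].
move=> x; have [x0|x0] := ltP 0 x; last by rewrite hl2_le0// !mulr0.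
have [pm mq] := m_pos x0; rewrite normrM [leRHS]normrM ler_wpM2r//.
by rewrite (ger0_norm (le_trans (ltW p0) pm)) (le_trans mq)// ler_norm.
Qed.

Let T (f : V) : V := Hl2 (mul_hl2 f).

Let T_linear : linear T.
Proof.
move=> a f g; apply/val_inj/funext => x.
transitivity (a * (m x * f x) + m x * g x); last by [].
by rewrite mulrCA -mulrDr.
Qed.

HB.instance Definition _ := GRing.isLinear.Build R V V *:%R T T_linear.

Let T_le (f : V) : dot (T f) (T f) <= q ^+ 2 * dot f f.
Proof.
rewrite !hl2_dotE -RintegralZl//; last by case: (hl2_sqint f).
apply: le_Rintegral => //.
- by case: (hl2_sqint (T f)).
- by apply: integrable_EFinZl; case: (hl2_sqint f).
move=> x _ /=; have [x0|x0] := ltP 0 x; last by rewrite hl2_le0// !mulr0 expr0n mulr0.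
have [pm mq] := m_pos x0; rewrite exprMn ler_wpM2r ?sqr_ge0//.
have m0 : 0 <= m x by rewrite (le_trans (ltW p0)).
by rewrite ler_pXn2r ?nnegrE// (le_trans m0).
Qed.

Let greenK_mul (f : V) s : 0 < s -> m s * greenK D f s = greenK D' (T f) s.
Proof.
move=> s0; rewrite /= /kernel_op -RintegralZl//; last first.
  exact: (schur_integrable (gker_schur D) s (hl2_sqint f)).
apply: eq_Rintegral => x _; rewrite /gker /m; case: ifP => sx; last by rewrite !mul0r mulr0.
have x0 := lt_le_trans s0 sx; rewrite !phi0_pos//.
have [? ? ?] := And3 (dec_gt0 D s0) (dec_gt0 D' s0) (dec_gt0 D' x0).
by field; rewrite !gt_eqF.
Qed.

Let green_form_mul (f : V) :
  green_form D f f <= p ^- 2 * green_form D' (T f) (T f).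
Proof.
rewrite /green_form !hl2_dotE -RintegralZl//; last by case: (hl2_sqint (greenK D' (T f))).
apply: le_Rintegral => //.
- by case: (hl2_sqint (greenK D f)).
- by apply: integrable_EFinZl; case: (hl2_sqint (greenK D' (T f))).
move=> s _; have [s0|s0] := ltP 0 s; last by rewrite !hl2_le0// expr0n mulr0.
rewrite -greenK_mul// exprMn mulrA -[leLHS]mul1r ler_wpM2r ?sqr_ge0//.
have [pm _] := m_pos s0.
rewrite mulrC ler_pdivlMr ?exprn_gt0// mul1r ler_pXn2r ?nnegrE ?(ltW p0)//.
exact: le_trans (ltW p0) pm.
Qed.

(** [p ^- 2] stems from the factor [m^-1] in front of the conjugated operator and [q ^+ 2] from the
    norm of the multiplication [T]; passing to inverses reverses the inequality. *)
Lemma green_eigenvalue_comparison e e' :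
  spectral_basis dot (green_form D) e -> spectral_basis dot (green_form D') e' ->
  forall n, green_eigenvalue D' e' n <= (q / p) ^+ 2 * green_eigenvalue D e n.
Proof.
move=> eS eS' n; have p20 : 0 <= p ^- 2 by rewrite invr_ge0 sqr_ge0.
have := eigenvalue_comparison hl2_dot_psd (green_form_psd D) p20 eS eS' green_form_mul T_le n.
have := sb_gt0 eS n; have := sb_gt0 eS' n; rewrite /green_eigenvalue.
set u := green_form _ _ _; set v := green_form _ _ _ => u0 v0.
move=> h; rewrite ler_pdivlMr// mulrC ler_pdivrMr// expr_div_n.
by rewrite (mulrC (q ^+ 2)).
Qed.

End Comparison.

Section SpectralBasisExists.
Context {R : realType}.

Lemma green_spectral_basis (phi : R -> R) kappa c (D : decaying phi kappa c) :
  exists e, spectral_basis (@hl2_dot R) (green_form D) e.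
Proof.
exact: (spectral_theorem hl2_dot_psd (green_form_psd D) hl2_complete
  (green_form_le D) (@green_form_eq0 _ _ _ _ D) (green_form_compact D) hl2_infinite_dim).
Qed.

End SpectralBasisExists.

Theorem corollary20 (R : realType)
  (phi dphi sigma dsigma d2sigma : R -> R) (c c1 c2 X : R)
  (phi_L2 : square_integrable half_line phi)
  (phi_gt0 : forall x : R, 0 <= x -> 0 < phi x)
  (phi_cont : {within `[0, +oo[%classic, continuous phi})
  (phi_deriv : weak_derivative_from 0 phi dphi)
  (dphi_L2loc : forall a : R, 0 < a -> square_integrable `]0, a[%classic dphi)
  (c_gt0 : 0 < c) (c1_gt0 : 0 < c1) (c2_gt0 : 0 < c2)
  (phi_bounds : forall x : R, 0 <= x ->
     c1 * expR (- sigma x) <= phi x /\ phi x <= c2 * expR (- sigma x))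
  (sigma_C1 : C1_half_line sigma dsigma)
  (dsigma_ge : forall x : R, 0 <= x -> c <= dsigma x)
  (X_ge0 : 0 <= X)
  (d2sigma_deriv : weak_derivative_from X dsigma d2sigma)
  (V_lim : dsigma x ^+ 2 - d2sigma x @[x --> +oo] --> +oo) :
  essential_spectrum (Hop phi) = set0 /\
  exists lam lamt : nat -> R,
    [/\ eigenvalue_enumeration (Hop phi) lam,
        eigenvalue_enumeration (Hop (fun x => expR (- sigma x))) lamt
      & exists2 C : R, 1 <= C &
          forall n : nat, C^-1 * lamt n <= lam n /\ lam n <= C * lamt n].
Proof.
have sinf := dsigma_unbounded sigma_C1 c_gt0 dsigma_ge X_ge0 d2sigma_deriv V_lim.
have bnd x : 0 < x -> c1 * expR (- sigma x) <= phi x /\ phi x <= c2 * expR (- sigma x).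
  by move=> /ltW; exact: phi_bounds.
have D := decaying_of_bounds phi_L2 sigma_C1 c_gt0 c1_gt0 c2_gt0 bnd dsigma_ge sinf.
have sE := square_integrable_expN phi_L2 sigma_C1 c1_gt0 (fun x x0 => (bnd x x0).1).
(* [exp (- sigma)] obeys its own bounds with both constants equal to [1], so the same construction
   covers it. *)
have bndE x : 0 < x -> 1 * expR (- sigma x) <= expR (- sigma x) /\
    expR (- sigma x) <= 1 * expR (- sigma x) by rewrite mul1r.
have D' := decaying_of_bounds sE sigma_C1 c_gt0 ltr01 ltr01 bndE dsigma_ge sinf.
have [e eS] := green_spectral_basis D; have [e' eS'] := green_spectral_basis D'.
split; first exact: essential_spectrum_eq0 eS.
exists (green_eigenvalue D e), (green_eigenvalue D' e'); split.
- exact: green_eigenvalue_enumeration eS.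
- exact: green_eigenvalue_enumeration eS'.
have c12 : c1 <= c2.
  have [h1 h2] := bnd 1 ltr01; have := le_trans h1 h2.
  by rewrite ler_pM2r// expR_gt0.
exists ((c2 / c1) ^+ 2); first by rewrite exprn_ege1// ler_pdivlMr// mul1r.
move=> n; split.
  rewrite ler_pdivrMl ?exprn_gt0 ?divr_gt0//.
  exact: (green_eigenvalue_comparison c1_gt0 bnd eS eS' n).
(* With the roles exchanged the bounds are [1 / c2] and [1 / c1], whose ratio is again [c2 / c1]:
   one [C] serves both sides. *)
have bnd' x : 0 < x -> c2^-1 * phi x <= expR (- sigma x) /\
    expR (- sigma x) <= c1^-1 * phi x.
  by move=> /bnd[h1 h2]; rewrite ler_pdivrMl// ler_pdivlMl.
have c2V : 0 < c2^-1 by rewrite invr_gt0.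
have := green_eigenvalue_comparison c2V bnd' eS' eS n.
by rewrite (_ : c1^-1 / c2^-1 = c2 / c1)// invrK mulrC.
Qed.
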